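(* Let $K=\mathbb{Q}(\sqrt2)$, let $\zeta_K$ be its Dedekind zeta function, and let $\mathcal{A}\subset\mathbb{R}^2$ be the Ammann-Beenker point set. The relative density of visible points $\kappa_{\mathcal{A}}=\frac{\theta(\widehat{\mathcal{A}})}{\theta(\mathcal{A})}$ of $\mathcal{A}$ exists and is given by $$\kappa_{\mathcal{A}}=\frac{2(\sqrt2-1)}{\zeta_K(2)}.$$
   Context: Density: a locally finite set $\mathcal{P}\subset\mathbb{R}^d$ has (asymptotic) density $\theta(\mathcal{P})$ if $\lim_{R\to\infty}\frac{\#(\mathcal{P}\cap RD)}{\mathrm{vol}(RD)}=\theta(\mathcal{P})$ for all Jordan measurable $D\subset\mathbb{R}^d$ with $\mathrm{vol}(D)>0$ (Jordan measurable: bounded with boundary of Lebesgue measure zero). The set of visible points of $\mathcal{P}$ is $\widehat{\mathcal{P}}=\{x\in\mathcal{P}\mid tx\notin\mathcal{P}\ \forall t\in(0,1)\}$. The relative density of visible points is $\kappa_{\mathcal{P}}=\theta(\widehat{\mathcal{P}})/\theta(\mathcal{P})$ when both densities exist and $\theta(\mathcal{P})>0$. Let $K=\mathbb{Q}(\sqrt2)\subset\mathbb{R}$ with ring of integers $\mathcal{O}_K=\mathbb{Z}[\sqrt2]$ and algebraic conjugation $x\mapsto\overline{x}$ ($\sqrt2\mapsto-\sqrt2$), applied coordinatewise to vectors: $\overline{(x_1,x_2)}=(\overline{x_1},\overline{x_2})$. Let $W_8\subset\mathbb{R}^2$ be the closed (solid) regular octagon of side length $1$ centered at the origin, with sides perpendicular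 to the coordinate axes (i.e. four of its sides are perpendicular to a coordinate axis), and let $\mathcal{W}_{\mathcal{A}}=\sqrt2\,W_8$. Put $$\mathcal{A}'=\{x=(x_1,x_2)\in\mathcal{O}_K^2\mid (x_1-x_2)/\sqrt2\in\mathcal{O}_K,\ \overline{x}\in\mathcal{W}_{\mathcal{A}}\}\subset\mathbb{R}^2.$$ The Ammann-Beenker point set is $\mathcal{A}=\frac{1}{\sqrt2}\mathcal{A}'$. *)

(* Defs.v *)
From HB Require Import structures.
From mathcomp Require Import all_boot all_order all_algebra.
From mathcomp Require Import finmap.
From mathcomp Require Import all_classical all_reals all_analysis.

Set Implicit Arguments.
Unset Strict Implicit.
Unset Printing Implicit Defensive.

Import Order.TTheory GRing.Theory Num.Theory.
Import numFieldNormedType.Exports.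

Local Open Scope classical_set_scope.
Local Open Scope ring_scope.

Section Density.
Variable R : realType.
Implicit Types (P D : set (R * R)) (r theta kappa : R).

(* Lebesgue outer measure of the plane: it agrees with the Lebesgue measure on
   every Lebesgue measurable set, and not only on the Borel sets, which matters
   because a Jordan measurable set need not be Borel. *)
Definition area D : \bar R :=
  mu_ext (lebesgue_measure \x lebesgue_measure)%E D.

Definition boundary D : set (R * R) := closure D `\` interior D.

Definition jordan_measurable D : Prop :=
  bounded_set D /\ area (boundary D) = 0%E.

Definition dilate r D : set (R * R) := [set r *: x | x in D].

Definition locally_finite P : Prop :=
  forall B : set (R * R), bounded_set B -> finite_set (P `&` B).

(* fset_set returns the empty set on an infinite set, and fine returns 0 on +oo;
   neither happens here, by local finiteness of P and boundedness of D. *)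
Definition has_density P theta : Prop :=
  locally_finite P /\
  forall D, jordan_measurable D -> (0 < area D)%E ->
    (#|` fset_set (P `&` dilate r D)|%:R / fine (area (dilate r D)))
      @[r --> +oo] --> theta.

Definition visible P : set (R * R) :=
  [set x | P x /\ forall t : R, 0 < t < 1 -> ~ P (t *: x)].

Definition has_relative_visible_density P kappa : Prop :=
  exists theta theta_vis : R,
    [/\ has_density P theta, has_density (visible P) theta_vis,
        0 < theta & kappa = theta_vis / theta].

End Density.

(* Here K is the underlying set of a number field embedded in R. *)
Section DedekindZeta.
Variable R : realType.
Implicit Types (K O I : set R) (s : R).

Definition ring_of_integers K : set R :=
  [set x | K x /\ integralOver (intr : int -> R) x].

Definition is_ideal O I : Prop :=
  [/\ I `<=` O, I 0,
      forall x y, I x -> I y -> I (x + y)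
    & forall a x, O a -> I x -> I (a * x)].

Definition nonzero_ideal O I : Prop :=
  is_ideal O I /\ exists2 x, I x & x != 0.

(* The index of the additive group I in O, i.e. the cardinality of O / I; this
   is finite for a nonzero ideal of a ring of integers. *)
Definition ideal_norm O I : nat :=
  #|` fset_set [set [set x + y | y in I] | x in O]|.

(* The defining Dirichlet series, to be used for real s > 1, where it
   converges. *)
Definition dedekind_zeta K s : R :=
  let O := ring_of_integers K in
  fine (\esum_(I in [set I | nonzero_ideal O I])
          ((ideal_norm O I)%:R `^ (- s))%:E).

End DedekindZeta.

Section AmmannBeenker.
Variable R : realType.

Local Notation sqrt2 := (Num.sqrt (2 : R)).

Definition Qsqrt2 : set R :=
  [set x | exists p q : rat, x = ratr p + ratr q * sqrt2].

(* The y below is unique for x in Qsqrt2, as sqrt2 is irrational. *)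
Definition conjK (x : R) : R :=
  xget 0 [set y | exists p q : rat,
                    x = ratr p + ratr q * sqrt2 /\ y = ratr p - ratr q * sqrt2].

(* The closed regular n-gon centered at the origin with the given side length
   and with outer normals at the angles 2 k pi / n: its inradius is
   side / (2 tan (pi / n)). *)
Definition regular_polygon (n : nat) (side : R) : set (R * R) :=
  [set x | forall k : nat, (k < n)%N ->
     x.1 * cos (2 * k%:R * pi / n%:R) + x.2 * sin (2 * k%:R * pi / n%:R)
       <= side / (2 * tan (pi / n%:R))].

Definition octagon : set (R * R) := regular_polygon 8 1.

Definition window : set (R * R) := dilate sqrt2 octagon.

Definition ammann_beenker_scaled : set (R * R) :=
  let O := ring_of_integers Qsqrt2 in
  [set x | [/\ O x.1, O x.2, O ((x.1 - x.2) / sqrt2)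
             & window (conjK x.1, conjK x.2)]].

Definition ammann_beenker : set (R * R) :=
  dilate sqrt2^-1 ammann_beenker_scaled.

End AmmannBeenker.

Arguments Qsqrt2 R : clear implicits.
Arguments ammann_beenker R : clear implicits.

(* Main.v *)
(**
Let [O = Z[sqrt 2]] and [M = {x in O^2 | x.1 - x.2 in sqrt 2 O}], with
conjugation written [x'].  For Jordan measurable [D] and [W], the number of
[x in M] with [x in r D] and [x' in l W] is asymptotic to
[(r l)^2 area(D) area(W) / 16]: boxes suffice, hence single coordinates.  In one
coordinate, a window of length 2 contains, for each value of the irrational
part, exactly one conjugate whose rational part has a given parity; multiplying
by powers of the totally positive unit [3 + 2 sqrt 2] makes any window long
while the relative error stays small.

Each nonzero [x in M] is uniquely [g p], with [p] primitive and [g] in a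
fundamental domain [G] for the units; [G] also indexes the nonzero ideals.
So if [e(r, l)] is the primitive count divided by [(r l)^2], minus its expected
limit [C / zeta_K(2)], then [sum_(g in G) N(g)^-2 e(r / g, l / g') -> 0].
Since [zeta_K(2) - 1 <= 5/6 < 1], isolating the term [g = 1] turns an asymptotic
bound [K] for [|e|], valid for all [l], into the bound [5/6 K]; hence [e -> 0],
and no Moebius inversion is needed.

Finally, [x] is visible if and only if it is primitive and its conjugate lies in
the window [W] but not in [(sqrt 2 - 1) W], whose area is [(sqrt 2 - 1)^2]
times that of [W].
*)
Require Import Defs.
From HB Require Import structures.
From mathcomp Require Import all_boot all_order all_algebra finmap.
From mathcomp Require Import all_classical all_reals all_analysis.
From mathcomp Require Import measurable_realfun.
From mathcomp Require Import zify ring lra.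

Set Implicit Arguments.
Unset Strict Implicit.
Unset Printing Implicit Defensive.
Import Order.TTheory GRing.Theory Num.Theory.
Import numFieldNormedType.Exports.
Local Open Scope classical_set_scope.
Local Open Scope ring_scope.

(** * The ring Z[sqrt 2] *)

(** The constant 16 is the covolume of M under the two embeddings: O has covolume 2 sqrt 2, so O^2
    has covolume 8, and M has index 2 in O^2. The obstacle in passing from all vectors to primitive
    ones is that dividing by g rescales the window by 1 / g' as well as the region by 1 / g. An
    estimate for a single window never closes on itself; hence [r] and [l] stay separate parameters,
    and the limit is taken in [r] for every fixed [l]. Exchanging this limit with the sum over g
    needs a bound by a multiple of (r l)^2, uniform in both parameters and without additive term. It
    holds because a nonzero element of O has norm at least 1 in absolute value. The factor sqrt 2 -
    1 governs visibility because, among the elements of O in the interval (0, 1), it has the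
    conjugate of least absolute value, 1 + sqrt 2: a primitive vector hidden by any multiple is
    already hidden by this one. *)

Record zs2 := ZS2 { rpart : int; ipart : int }.

Definition zs2_pair (x : zs2) := (rpart x, ipart x).
Definition pair_zs2 (p : int * int) := ZS2 p.1 p.2.
Lemma zs2_pairK : cancel zs2_pair pair_zs2. Proof. by case. Qed.

HB.instance Definition _ := Countable.copy zs2 (can_type zs2_pairK).

Lemma zs2_eqP (x y : zs2) : rpart x = rpart y -> ipart x = ipart y -> x = y.
Proof. by case: x y => [a b] [c d] /= -> ->. Qed.

Definition zs2_add (x y : zs2) := ZS2 (rpart x + rpart y) (ipart x + ipart y).
Definition zs2_opp (x : zs2) := ZS2 (- rpart x) (- ipart x).
Definition zs2_mul (x y : zs2) :=
  ZS2 (rpart x * rpart y + 2 * ipart x * ipart y)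
      (rpart x * ipart y + ipart x * rpart y).

Lemma zs2_addA : associative zs2_add.
Proof. by move=> x y z; apply: zs2_eqP => /=; ring. Qed.
Lemma zs2_addC : commutative zs2_add.
Proof. by move=> x y; apply: zs2_eqP => /=; ring. Qed.
Lemma zs2_add0 : left_id (ZS2 0 0) zs2_add.
Proof. by move=> x; apply: zs2_eqP => /=; ring. Qed.
Lemma zs2_addN : left_inverse (ZS2 0 0) zs2_opp zs2_add.
Proof. by move=> x; apply: zs2_eqP => /=; ring. Qed.
HB.instance Definition _ :=
  GRing.isZmodule.Build zs2 zs2_addA zs2_addC zs2_add0 zs2_addN.

Lemma zs2_mulA : associative zs2_mul.
Proof. by move=> x y z; apply: zs2_eqP => /=; ring. Qed.
Lemma zs2_mulC : commutative zs2_mul.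
Proof. by move=> x y; apply: zs2_eqP => /=; ring. Qed.
Lemma zs2_mul1 : left_id (ZS2 1 0) zs2_mul.
Proof. by move=> x; apply: zs2_eqP => /=; ring. Qed.
Lemma zs2_mulD : left_distributive zs2_mul +%R.
Proof. by move=> x y z; apply: zs2_eqP => /=; ring. Qed.
Lemma zs2_1neq0 : ZS2 1 0 != 0. Proof. by []. Qed.
HB.instance Definition _ := GRing.Zmodule_isComNzRing.Build zs2
  zs2_mulA zs2_mulC zs2_mul1 zs2_mulD zs2_1neq0.

Lemma rpartM x y : rpart (x * y) = rpart x * rpart y + 2 * ipart x * ipart y.
Proof. by []. Qed.
Lemma ipartM x y : ipart (x * y) = rpart x * ipart y + ipart x * rpart y.
Proof. by []. Qed.
Lemma rpartD x y : rpart (x + y) = rpart x + rpart y. Proof. by []. Qed.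
Lemma ipartD x y : ipart (x + y) = ipart x + ipart y. Proof. by []. Qed.
Lemma rpartN x : rpart (- x) = - rpart x. Proof. by []. Qed.
Lemma ipartN x : ipart (- x) = - ipart x. Proof. by []. Qed.
Lemma rpart0 : rpart 0 = 0. Proof. by []. Qed.
Lemma ipart0 : ipart 0 = 0. Proof. by []. Qed.
Lemma rpart1 : rpart 1 = 1. Proof. by []. Qed.
Lemma ipart1 : ipart 1 = 0. Proof. by []. Qed.
Definition partE := (rpartM, ipartM, rpartD, ipartD, rpartN, ipartN,
  rpart0, ipart0, rpart1, ipart1).

Definition nrm (x : zs2) : int := rpart x ^+ 2 - 2 * ipart x ^+ 2.
Definition cj (x : zs2) := ZS2 (rpart x) (- ipart x).

Lemma nrmM x y : nrm (x * y) = nrm x * nrm y.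
Proof. by rewrite /nrm !partE; ring. Qed.

Lemma nrm1 : nrm 1 = 1. Proof. by []. Qed.

Lemma mul_cj x : x * cj x = ZS2 (nrm x) 0.
Proof. by apply: zs2_eqP; rewrite !partE /nrm /=; ring. Qed.

Lemma int_parity (z : int) : (exists y, z = 2 * y) \/ (exists y, z = 2 * y + 1).
Proof.
have E := divz_eq z 2; have [h|h] : (z %% 2)%Z = 0 \/ (z %% 2)%Z = 1 by lia.
  by left; exists (z %/ 2)%Z; lia.
by right; exists (z %/ 2)%Z; lia.
Qed.

(** Infinite descent: both [a] and [b] are even, and halving them gives a solution with smaller
    [b]. *)
Lemma int_sq_2sq (a b : int) : a ^+ 2 = 2 * b ^+ 2 -> b = 0.
Proof.
have [n ltn] := ubnP `|b|%N; elim: n => // n IH in a b ltn * => E.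
have [a' Ea] : exists a' : int, a = 2 * a'.
  by case: (int_parity a) => // -[y yE]; move: E; rewrite yE; lia.
have E' : b ^+ 2 = 2 * a' ^+ 2 by move: E; rewrite Ea; nia.
have [b' Eb] : exists b' : int, b = 2 * b'.
  by case: (int_parity b) => // -[y yE]; move: E'; rewrite yE; lia.
case: (eqVneq b 0) => // bn0.
have := IH a' b'; rewrite Eb => -> //; last by move: E'; rewrite Eb; nia.
by move: ltn bn0; rewrite Eb; lia.
Qed.

Lemma nrm_eq0 x : (nrm x == 0) = (x == 0).
Proof.
apply/eqP/eqP => [|->] //; rewrite /nrm => /subr0_eq E.
have i0 := int_sq_2sq E; apply: zs2_eqP => //=.
by move: E; rewrite i0; nia.
Qed.

Lemma zs2_mulf_eq0 (x y : zs2) : x * y = 0 -> (x == 0) || (y == 0).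
Proof. by move=> E; rewrite -!nrm_eq0 -mulf_eq0 -nrmM E. Qed.

Definition zs2_unit : pred zs2 := fun x => `|nrm x|%N == 1%N.
(** A unit has norm 1 or -1, which is its own inverse, so the norm times the conjugate inverts it.
    Other elements are fixed, as the unit ring interface requires. *)
Definition zs2_inv (x : zs2) :=
  if zs2_unit x then ZS2 (nrm x) 0 * cj x else x.

Lemma zs2_mulVr : {in zs2_unit, left_inverse 1 zs2_inv *%R}.
Proof.
move=> x ux; rewrite /zs2_inv [zs2_unit x]ux -mulrA (mulrC (cj x)) mul_cj.
have [n1|n1] : nrm x = 1 \/ nrm x = -1; last 2 first.
- by rewrite n1.
- by rewrite n1.
by move: ux; rewrite -[x \in _]/(`|nrm x|%N == 1%N); lia.
Qed.
Lemma zs2_unitP (x y : zs2) : y * x = 1 -> zs2_unit x.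
Proof.
move/(congr1 (fun z => `|nrm z|%N)); rewrite nrmM nrm1 abszM => /eqP.
by rewrite muln_eq1 => /andP[].
Qed.
Lemma zs2_inv_out : {in [predC zs2_unit], zs2_inv =1 id}.
Proof. by move=> x xnu; rewrite /zs2_inv [zs2_unit x](negbTE xnu). Qed.

HB.instance Definition _ := GRing.ComNzRing_hasMulInverse.Build zs2
  zs2_mulVr zs2_unitP zs2_inv_out.
HB.instance Definition _ := GRing.ComUnitRing_isIntegral.Build zs2 zs2_mulf_eq0.

Lemma unit_nrm x : (x \is a GRing.unit) = (`|nrm x|%N == 1%N).
Proof. by []. Qed.

(** * Euclidean division and principal ideals *)

Lemma int_round (u n : int) : n != 0 -> exists q : int, (2 * `|u - q * n| <= `|n|).
Proof.
move=> n0; have E := divz_eq u n; have r0 := modz_ge0 u n0.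
have rn := ltz_mod u n0; set q := (u %/ n)%Z in E *; set r := (u %% n)%Z in E r0 rn *.
have [h|h] := leP (2 * r) `|n|; first by exists q; rewrite E; lia.
have [n1|n1] := ltP 0 n.
  by exists (q + 1); rewrite E mulrDl; lia.
by exists (q - 1); rewrite E mulrBl; lia.
Qed.

(** Rounding both coordinates of x / g = x g' / N(g) leaves a + b sqrt 2 with |a| and |b| at most
    1/2, and a^2 - 2 b^2 then lies between -1/2 and 1/4. *)
Lemma zs2_euclid (x g : zs2) : g != 0 ->
  exists q, (`|nrm (x - q * g)%R| < `|nrm g|)%N.
Proof.
rewrite -nrm_eq0; set n := nrm g => n0.
have [q1 h1] := int_round (rpart (x * cj g)) n0.
have [q2 h2] := int_round (ipart (x * cj g)) n0.
exists (ZS2 q1 q2); set y := x - _.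
have E : y * cj g = ZS2 (rpart (x * cj g) - q1 * n) (ipart (x * cj g) - q2 * n).
  rewrite /y mulrBl -mulrA mul_cj -/n.
  by apply: zs2_eqP; rewrite !partE /=; ring.
have ncj : nrm (cj g) = n by rewrite /n /nrm /= sqrrN.
move/(congr1 nrm): E; rewrite nrmM ncj {2}/nrm /=.
set a := _ - _ in h1 *; set b := _ - _ in h2 *; set m := nrm y => E.
have sq4 c : 2 * `|c| <= `|n| -> 4 * c ^+ 2 <= n ^+ 2.
  rewrite -(real_normK (num_real n)) -(real_normK (num_real c)) => h.
  have -> : 4 * `|c| ^+ 2 = (2 * `|c|) ^+ 2 by ring.
  by rewrite ler_pXn2r ?nnegrE ?mulr_ge0.
have {h1} ha := sq4 _ h1; have {h2} hb := sq4 _ h2.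
have a2 := sqr_ge0 a; have b2 := sqr_ge0 b.
rewrite -ltz_nat !abszE; have np : 0 < `|n| by rewrite normr_gt0.
rewrite -(ltr_pM2r np) -normrM E -normrM -expr2 (ger0_norm (sqr_ge0 n)) ltr_norml.
have : 0 < n ^+ 2 by rewrite exprn_even_gt0.
by lia.
Qed.

(** Euclid's descent: a nonzero element of [I] that fails to divide some element of [I] leaves a
    nonzero remainder in [I] of smaller norm. *)
Lemma zs2_principal (I : zs2 -> Prop) :
    (forall x y, I x -> I y -> I (x + y)) -> (forall a x, I x -> I (a * x)) ->
    (exists2 x, I x & x != 0) ->
  exists2 g, g != 0 & forall x, I x <-> exists y, x = y * g.
Proof.
move=> ID IM [x Ix x0]; have [n ltn] := ubnP `|nrm x|%N.
elim: n => // n IH in x Ix x0 ltn *.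
have [allx|] := pselect (forall y, I y -> exists z, y = z * x).
  by exists x => // y; split => [/allx//|[z ->]]; exact: IM.
move=> /existsNP[y /not_implyP[Iy ny]]; have [q hq] := zs2_euclid y x0.
apply: (IH (y - q * x)).
- by rewrite -mulNr; exact: ID (IM _ _ Ix).
- by apply: contra_notN ny => /eqP/subr0_eq ->; exists q.
- by lia.
Qed.

Lemma zs2_bezout (x y : zs2) : x != 0 ->
  exists h x' y' u v, [/\ x = x' * h, y = y' * h, h != 0 & u * x' + v * y' = 1].
Proof.
move=> x0; have [|||h h0 Ih] := @zs2_principal (fun z => exists u v, z = u * x + v * y).
- move=> _ _ [a [b ->]] [c [d ->]]; exists (a + c), (b + d); ring.
- move=> a _ [b [c ->]]; exists (a * b), (a * c); ring.
- by exists x => //; exists 1, 0; ring.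
have [x' Ex] : exists z, x = z * h by apply/Ih; exists 1, 0; ring.
have [y' Ey] : exists z, y = z * h by apply/Ih; exists 0, 1; ring.
have [u [v E]] : exists u v, h = u * x + v * y by apply/Ih; exists 1; ring.
exists h, x', y', u, v; split => //; apply: (mulIf h0).
by rewrite mul1r [RHS]E Ex Ey; ring.
Qed.

(* A fundamental domain for the units: [reduced x] is equivalent to [x] and its
   conjugate being positive with ratio in the half-open interval from [v^-1]
   (excluded) to [v] (included), where [v = sqfunit]. *)
Definition reduced (x : zs2) :=
  [&& 1 <= rpart x, - rpart x < 2 * ipart x & 2 * ipart x <= rpart x].

Definition eps := ZS2 1 1.
(* The square of the fundamental unit [eps], and its inverse. *)
Definition sqfunit := ZS2 3 2.
Definition sqfunitV := ZS2 3 (-2).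

Lemma reduced_nrm_gt0 x : reduced x -> 0 < nrm x.
Proof. by case/and3P => h1 h2 h3; rewrite /nrm; nia. Qed.

(** Descent on the rational part: while the ratio of [x] to its conjugate lies outside the closed
    interval, multiplying by [sqfunit] or its inverse lowers the rational part, and the positive
    norm keeps it positive. *)
Lemma totpos_inG x : 0 < rpart x -> 0 < nrm x ->
  exists2 u, u \is a GRing.unit & reduced (u * x).
Proof.
have [n ltn] := ubnP `|rpart x|%N.
elim: n => // n IH in x ltn * => a0 n0.
have step w (uw : w \is a GRing.unit) : nrm w = 1 -> 0 < rpart (w * x) ->
  (`|rpart (w * x)%R| < `|rpart x|)%N -> exists2 u, u \is a GRing.unit & reduced (u * x).
  move=> nw ap lt; have [||| u uu Gu] := IH (w * x) => //; first lia.
    by rewrite nrmM nw mul1r.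
  by exists (u * w); rewrite ?unitrM ?uu // -mulrA.
have [h1|h1] := ltP (rpart x) (2 * ipart x).
  by apply: (step sqfunitV) => //; rewrite rpartM /=; move: n0; rewrite /nrm; nia.
have [h2|h2] := ltP (2 * ipart x) (- rpart x).
  by apply: (step sqfunit) => //; rewrite rpartM /=; move: n0; rewrite /nrm; nia.
(* At the excluded endpoint one more multiplication lands on the included one, with the same
   rational part. *)
have [h3|h3] := eqVneq (2 * ipart x) (- rpart x).
  by exists sqfunit => //; rewrite /reduced !partE /=; lia.
by exists 1; rewrite ?unitr1 // mul1r /reduced; lia.
Qed.

(** [eps] has norm -1 and repairs the sign of the norm; -1 then repairs the sign of the rational
    part. *)
Lemma reduced_exists x : x != 0 -> exists2 u, u \is a GRing.unit & reduced (u * x).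
Proof.
rewrite -nrm_eq0 => n0; wlog n1 : x n0 / 0 < nrm x.
  move=> H; have [|] := ltP 0 (nrm x); first exact: H.
  move=> n1; have [||u uu Gu] := H (eps * x); rewrite ?nrmM ?mulf_neq0//.
    by rewrite /nrm/= in n0 n1 *; lia.
  by exists (u * eps); rewrite ?unitrM ?uu // -mulrA.
have [a0|a0] := ltP 0 (rpart x); first exact: totpos_inG.
have [||u uu Gu] := @totpos_inG (- x).
- rewrite partE oppr_gt0 lt_neqAle a0 andbT; apply: contraTneq n1.
  by rewrite /nrm => ->; nia.
- by rewrite -mulN1r nrmM mul1r.
by exists (- u); rewrite ?unitrN // mulNr -mulrN.
Qed.

(** Such a unit u = s + t sqrt 2 has t >= 2, that is, u >= v with v = 3 + 2 sqrt 2. It multiplies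
    the ratio of [x] to its conjugate by u^2 >= v^2, which leads out of the interval from v^-1
    (excluded) to v. *)
Lemma reduced_unit_lt x u : reduced x -> nrm u = 1 -> 0 < rpart u -> 0 < ipart u ->
  ~~ reduced (u * x).
Proof.
case/and3P => h1 h2 h3; rewrite /nrm => nu s0 t0; apply/negP; case/and3P; rewrite !partE.
set a := rpart x in h1 h2 h3 *; set b := ipart x in h1 h2 h3 *.
set s := rpart u in nu s0 *; set t := ipart u in nu t0 *.
move=> k1 k2 k3.
have st : t < s by nia.
have t2 : 2 <= t.
  rewrite leNgt; apply/negP => t1; have {}t1 : t = 1 by lia.
  have [|] := leP s 1; nia.
(* This follows from s^2 = 1 + 2 t^2 and t >= 2, and is what turns 2 b > -a into 2 (s b + t a) > s a
   + 2 t b. *)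
have st3 : 2 * s <= 3 * t by nia.
have : (2 * (s - t)) * b > - (s - t) * a by nia.
nia.
Qed.

Lemma reduced_unique x u : reduced x -> u \is a GRing.unit -> reduced (u * x) -> u = 1.
Proof.
move=> Gx uu Gu; have n0 := reduced_nrm_gt0 Gx; have := reduced_nrm_gt0 Gu.
rewrite nrmM pmulr_lgt0 // => nu0.
have nu : nrm u = 1 by move: uu nu0; rewrite unit_nrm; lia.
have s0 : 0 < rpart u.
  rewrite ltNge; apply/negP => s0; case/and3P: Gx => h1 h2 h3.
  case/and3P: Gu; rewrite !partE => k1 _ _; move: nu; rewrite /nrm => nu.
  set t := ipart u in nu k1 *; set s := rpart u in s0 k1 nu *.
  have st : `|t| < - s by nia.
  have : 2 * t * ipart x <= `|t| * rpart x.
    have [t0|t0] := ltP t 0; nia.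
  by nia.
have [t0|t0|t0] := ltgtP (ipart u) 0.
(* The inverse of [u] is its conjugate, which has positive irrational part and takes [u * x] back to
   [x]. *)
- have := @reduced_unit_lt (u * x) (cj u) Gu; rewrite mulrA (mulrC (cj u)) mul_cj nu.
  have ncu : nrm (cj u) = 1 by rewrite -nu /nrm /= sqrrN.
  by rewrite mul1r Gx /= => /(_ ncu s0); rewrite oppr_gt0 => /(_ t0).
- by move: (reduced_unit_lt Gx nu s0 t0); rewrite Gu.
- by apply: zs2_eqP => //; move: nu; rewrite partE /nrm t0; nia.
Qed.

(** * Integers of Q(sqrt 2) *)

Lemma int_mul_eq1 (a b : int) : a * b = 1 -> a = 1 \/ a = -1.
Proof.
move/(congr1 absz); rewrite abszM => /eqP; rewrite muln_eq1 => /andP[/eqP h _].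
by lia.
Qed.

(** Gauss's lemma: the divisor is a rational multiple of an integer factor of [f], whose leading
    coefficient must be 1 or -1. *)
Lemma int_poly_coef (m : {poly rat}) (f : {poly int}) :
  m \is monic -> f \is monic -> m %| map_poly intr f ->
  exists g : {poly int}, m = map_poly intr g.
Proof.
move=> mm mf /dvdpP_rat_int[g [a a0 E] [r Er]].
have lg : lead_coef g * lead_coef r = 1.
  by rewrite -lead_coefM -Er; exact/eqP.
have am : a * (lead_coef g)%:~R = 1.
  move/monicP: mm; rewrite E lead_coefZ lead_coef_map_inj //.
  exact: intr_inj.
have [lg1|lg1] : lead_coef g = 1 \/ lead_coef g = -1 by exact: int_mul_eq1 lg.
  by exists g; rewrite E; move: am; rewrite lg1 mulr1 => ->; rewrite scale1r.
exists (- g); rewrite E rmorphN /=; move: am; rewrite lg1 rmorphN mulrN1.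
by move/(congr1 -%R); rewrite opprK => ->; rewrite scaleN1r.
Qed.

Lemma rat_sqr_int (p : rat) : p ^+ 2 \is a Num.int -> p \is a Num.int.
Proof.
case/intrP => n E.
have [|||g Eg] := @int_poly_coef ('X - p%:P) ('X^2 - n%:P).
- exact: monicXsubC.
- by rewrite monicXnsubC.
- by rewrite dvdp_XsubCl rmorphB /= map_polyXn map_polyC /= /root !hornerE /= -E subrr.
have := congr1 (fun h : {poly rat} => h`_0) Eg.
rewrite coefB coefX coefC coef_map /= sub0r => /(congr1 -%R).
by rewrite opprK -rmorphN => /= ->; exact: intr_int.
Qed.

(** The hypotheses are integrality of the trace and of the norm N of p + q sqrt 2. Then (4 q)^2 = 2
    (2 p)^2 - 8 N is an integer, hence so is 4 q, and parity removes the denominators one factor 2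
    at a time. *)
Lemma rat_2sq_int (p q : rat) :
  2 * p \is a Num.int -> p ^+ 2 - 2 * q ^+ 2 \is a Num.int ->
  p \is a Num.int /\ q \is a Num.int.
Proof.
move=> /intrP[u Eu] /intrP[w Ew].
have : 4 * q \is a Num.int.
  apply: rat_sqr_int; apply/intrP; exists (2 * u ^+ 2 - 8 * w).
  by rewrite rmorphB /= !rmorphM /= -Ew ?rmorphXn /= -Eu; ring.
case/intrP => v Ev.
have E : 2 * u ^+ 2 - v ^+ 2 = 8 * w.
  apply: (intr_inj (R := rat)).
  by rewrite rmorphB /= !rmorphM /= ?rmorphXn /= -Eu -Ev -Ew; ring.
have [v' Ev'] : exists v', v = 2 * v'.
  by case: (int_parity v) => // -[y yE]; move: E; rewrite yE; lia.
have {}E : u ^+ 2 - 2 * v' ^+ 2 = 4 * w by move: E; rewrite Ev'; lia.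
have [u' Eu'] : exists u', u = 2 * u'.
  by case: (int_parity u) => // -[y yE]; move: E; rewrite yE; lia.
have {}E : 2 * u' ^+ 2 - v' ^+ 2 = 2 * w by move: E; rewrite Eu'; lia.
have [v2 Ev2] : exists v2, v' = 2 * v2.
  by case: (int_parity v') => // -[y yE]; move: E; rewrite yE; lia.
split; apply/intrP.
  by exists u'; apply: (@mulfI _ 2) => //; rewrite Eu Eu' rmorphM.
by exists v2; apply: (@mulfI _ 4) => //; rewrite Ev Ev' Ev2 !rmorphM /=; ring.
Qed.

Section Sqrt2.
Variable R : rcfType.
Local Notation s2 := (Num.sqrt (2 : R)).

Lemma sqrt2_sqr : s2 ^+ 2 = 2. Proof. by rewrite sqr_sqrtr. Qed.
Lemma sqrt2_gt0 : 0 < s2. Proof. by rewrite sqrtr_gt0. Qed.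
Lemma sqrt2_bounds : (141%:R / 100%:R < s2) && (s2 < 142%:R / 100%:R).
Proof.
have := sqrt2_sqr; have := sqrt2_gt0; set t := s2 => t0 t2.
by apply/andP; split; rewrite ltNge; apply/negP => h; nra.
Qed.

Lemma rat_sqrt2_irr (p q : rat) : p ^+ 2 = 2 * q ^+ 2 -> q = 0.
Proof.
rewrite -[p]divq_num_den -[q]divq_num_den => E.
have dp0 : (denq p)%:~R != 0 :> rat by rewrite intr_eq0 denq_neq0.
have dq0 : (denq q)%:~R != 0 :> rat by rewrite intr_eq0 denq_neq0.
have : (numq p * denq q) ^+ 2 = 2 * (numq q * denq p) ^+ 2.
  apply: (intr_inj (R := rat)); rewrite rmorphM /= ?rmorphXn /= !rmorphM /=.
  move: E; rewrite !expr_div_n => E.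
  move: E; set a := (numq p)%:~R; set b := (denq p)%:~R.
  set c := (numq q)%:~R; set d := (denq q)%:~R => E.
  have b0 : b != 0 by [].
  have d0 : d != 0 by [].
  transitivity (a ^+ 2 / b ^+ 2 * (b ^+ 2 * d ^+ 2)); first by field.
  by rewrite E; field.
move/int_sq_2sq/eqP; rewrite mulf_eq0 (negbTE (denq_neq0 _)) orbF => /eqP ->.
by rewrite mul0r.
Qed.

Lemma ratr_sqrt2_eq0 (p q : rat) : ratr p + ratr q * s2 = 0 -> p = 0 /\ q = 0.
Proof.
move=> /eqP; rewrite addr_eq0 => /eqP E.
have q0 : q = 0.
  apply: (@rat_sqrt2_irr p); apply: (fmorph_inj (ratr : rat -> R)).
  by rewrite rmorphXn /= E rmorphM rmorphXn /= sqrrN exprMn sqrt2_sqr ratr_nat mulrC.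
move: E; rewrite q0 rmorph0 mul0r oppr0 => /eqP.
by rewrite fmorph_eq0 => /eqP.
Qed.

Lemma ratr_sqrt2_inj (p q p' q' : rat) :
  ratr p + ratr q * s2 = ratr p' + ratr q' * s2 -> p = p' /\ q = q'.
Proof.
move=> E; have [|/subr0_eq-> /subr0_eq->//] := @ratr_sqrt2_eq0 (p - p') (q - q').
rewrite !rmorphB /= mulrBl; rewrite addrACA -opprD.
by rewrite E subrr.
Qed.

(** The minimal polynomial, X - p if q = 0 and X^2 - 2 p X + (p^2 - 2 q^2) otherwise, divides the
    given monic integer polynomial, so its coefficients are integers. *)
Lemma integral_Qsqrt2 (p q : rat) :
  integralOver (intr : int -> R) (ratr p + ratr q * s2) ->
  p \is a Num.int /\ q \is a Num.int.
Proof.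
case=> f mf; set x := _ + _ => rx.
pose fQ : {poly rat} := map_poly intr f.
have fE : map_poly ratr fQ = map_poly intr f :> {poly R}.
  by rewrite -map_poly_comp; apply: eq_map_poly => z /=; rewrite ratr_int.
have rQ : root (map_poly ratr fQ) x by rewrite fE.
have [q0|q0] := eqVneq q 0.
  move: rQ; rewrite /x q0 rmorph0 mul0r addr0 fmorph_root => rp.
  split; last by rewrite rpred0.
  have [|g Eg] := @int_poly_coef ('X - p%:P) f (monicXsubC _) mf.
    by rewrite dvdp_XsubCl.
  have := congr1 (fun h : {poly rat} => h`_0) Eg.
  rewrite coefB coefX coefC coef_map /= sub0r => /(congr1 -%R).
  by rewrite opprK -rmorphN => /= ->; exact: intr_int.
have [n0 n0E] : exists n0, n0 = p ^+ 2 - 2 * q ^+ 2 by exists (p ^+ 2 - 2 * q ^+ 2).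
pose m : {poly rat} := 'X^2 - ((2 * p) *: 'X - n0%:P).
have sz : (size ((2 * p) *: 'X - n0%:P)%R < 3)%N.
  rewrite ltnS (leq_trans (size_polyD _ _)) // geq_max size_polyN.
  rewrite (leq_trans (size_scale_leq _ _)) ?size_polyX //=.
  by rewrite (leq_trans (size_polyC_leq1 _)).
have mm : m \is monic.
  by rewrite monicE lead_coefDl ?lead_coefXn // size_polyN size_polyXn.
have szm : size m = 3 by rewrite /m size_polyDl size_polyXn // size_polyN.
have mx : (map_poly ratr m).[x] = 0.
  rewrite /m !rmorphB /= map_polyXn map_polyZ /= map_polyX map_polyC /= !hornerE /=.
  rewrite /x n0E rmorphB !rmorphM /= !ratr_nat.
  have := sqrt2_sqr; set t := s2; set a := ratr p; set b := ratr q => t2.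
  transitivity (b ^+ 2 * (t ^+ 2 - 2)); last by rewrite t2 subrr mulr0.
  by ring.
(* The remainder has degree at most 1 and vanishes at [x]; 1 and sqrt 2 being independent over the
   rationals, it is 0. *)
have dm : m %| fQ.
  rewrite /dvdp; set r := fQ %% m.
  have szr : (size r <= 2)%N.
    by have := ltn_modp fQ m; rewrite -size_poly_eq0 szm ltnS.
  have : (map_poly ratr r).[x] = 0.
    move: rQ; rewrite [fQ](divp_eq _ m) rmorphD rmorphM /= /root hornerD hornerM mx mulr0 add0r.
    by move/eqP.
  rewrite (@horner_coef_wide _ 2) ?size_map_poly // !big_ord_recl big_ord0 /=.
  rewrite !coef_map /= expr0 expr1 mulr1 addr0 /x /bump /= => E.
  have [] : r`_0 + r`_1 * p = 0 /\ r`_1 * q = 0.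
    apply: ratr_sqrt2_eq0; rewrite -E rmorphD !rmorphM /=.
    by rewrite addn0; ring.
  move=> h1 /eqP; rewrite mulf_eq0 (negbTE q0) orbF => /eqP h2.
  move: h1; rewrite h2 mul0r addr0 => h1.
  apply/eqP/polyP => i; rewrite coef0; case: i => [|[|i]] //.
  by rewrite nth_default // (leq_trans szr).
have [g Eg] := int_poly_coef mm mf dm.
have c0 := congr1 (fun h : {poly rat} => h`_0) Eg.
have c1 := congr1 (fun h : {poly rat} => h`_1) Eg.
move: c0 c1; rewrite !coef_map /= !(coefD, coefN, coefXn, coefZ, coefX, coefC) /=.
have -> : forall a b : rat, 0 - (a * 0 - b) = b by move=> *; ring.
have -> : forall a : rat, 0 - (a * 1 - 0) = - a by move=> *; ring.
rewrite n0E => c0 /(congr1 -%R); rewrite opprK -rmorphN /= => c1.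
by apply: rat_2sq_int; [rewrite c1 | rewrite c0]; exact: intr_int.
Qed.

End Sqrt2.

(** * Cardinals of finite sets *)

Section Counting.

(** The counting function used in the density. It is 0 on infinite sets, so finiteness travels along
    with the counts below. *)
Definition cnt (T : choiceType) (A : set T) : nat := #|` fset_set A|.

Lemma cnt_le (T : choiceType) (A B : set T) :
  finite_set B -> A `<=` B -> (cnt A <= cnt B)%N.
Proof.
move=> fB AB; apply: fsubset_leq_card; rewrite -fset_set_sub//.
exact: sub_finite_set fB.
Qed.

Lemma cnt_image (T U : choiceType) (f : T -> U) (A : set T) :
  finite_set A -> {in A &, injective f} -> cnt (f @` A) = cnt A.
Proof.
move=> fA fi; rewrite /cnt fset_set_image// card_in_imfset//= => x y.
by rewrite !in_fset_set//; exact: fi.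
Qed.

Lemma inj_finite_cnt (T U : choiceType) (f : T -> U) (A : set T) (B : set U) :
  finite_set B -> {in A &, injective f} -> (forall x, A x -> B (f x)) ->
  finite_set A /\ (cnt A <= cnt B)%N.
Proof.
move=> fB fi AB; have fA : finite_set A.
  have fin : finite_set (f @` A) by apply: sub_finite_set fB => _ [x Ax <-]; exact: AB.
  by rewrite -(eq_finite_set (inj_card_eq fi)).
split=> //; rewrite -(cnt_image fA fi); apply: cnt_le => //.
by move=> _ [x Ax <-]; exact: AB.
Qed.

Lemma cnt_II n : cnt `I_n = n.
Proof. exact/card_fset_set/card_eqxx. Qed.

Lemma cnt0 (T : choiceType) : cnt (set0 : set T) = 0%N.
Proof. by rewrite /cnt fset_set0 cardfs0. Qed.

Lemma cntU (T : choiceType) (A B : set T) : finite_set A -> finite_set B ->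
  A `&` B = set0 -> cnt (A `|` B) = (cnt A + cnt B)%N.
Proof.
move=> fA fB AB; rewrite /cnt fset_setU// cardfsU -fset_setI// AB fset_set0.
by rewrite cardfs0 subn0.
Qed.

Lemma cnt_bigcup (T : choiceType) (I : eqType) (s : seq I) (F : I -> set T) :
  uniq s -> (forall i, i \in s -> finite_set (F i)) ->
  (forall i j x, i \in s -> j \in s -> F i x -> F j x -> i = j) ->
  finite_set (\bigcup_(i in [set` s]) F i) /\
  cnt (\bigcup_(i in [set` s]) F i) = (\sum_(i <- s) cnt (F i))%N.
Proof.
elim: s => [|i s IH] /= => [_ _ _|/andP[si us] Ffin Fdis].
  have -> : \bigcup_(i in [set` [::]]) F i = set0.
    by apply/seteqP; split=> [x [i]|].
  by rewrite big_nil cnt0; split; first exact: finite_set0.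
have [||fs cs] := IH us.
- by move=> j js; apply: Ffin; rewrite inE js orbT.
- by move=> j k x js ks; apply: Fdis; rewrite inE ?js ?ks orbT.
have fi : finite_set (F i) by apply: Ffin; rewrite mem_head.
have -> : \bigcup_(k in [set` i :: s]) F k = F i `|` \bigcup_(k in [set` s]) F k.
  apply/seteqP; split=> [x [k /=]|x [Fx|[k ks Fx]]].
  - by rewrite inE => /orP[/eqP->|ks Fx]; [left|right; exists k].
  - by exists i => //=; rewrite mem_head.
  - by exists k => //=; rewrite inE ks orbT.
rewrite big_cons; split.
  by rewrite finite_setU.
rewrite cntU ?cs//; apply/eqP/negPn/negP => /set0P[x [Fi [j js Fj]]].
have E : i = j by apply: (Fdis i j x) => //; rewrite ?mem_head// inE js orbT.
by move: si; rewrite E; move/negP; apply.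
Qed.

Lemma cntX (T U : choiceType) (A : set T) (B : set U) :
  finite_set A -> finite_set B -> cnt (A `*` B) = (cnt A * cnt B)%N.
Proof.
move=> fA fB; pose F (a : T) : set (T * U) := pair a @` B.
have -> : A `*` B = \bigcup_(a in [set` (fset_set A : seq T)]) F a.
  apply/seteqP; split=> [[a b] /= [Aa Bb]|_ [a aA [b Bb <-]]].
    by exists a; [rewrite /= in_fset_set// mem_set|exists b].
  by split=> //=; move: aA; rewrite /= in_fset_set// inE.
have [||_ ->] := @cnt_bigcup _ _ (fset_set A) F (fset_uniq _).
- by move=> a _; exact: finite_image.
- by move=> a a1 x _ _ [b _ <-] [b1 _ [-> _]].
rewrite (eq_bigr (fun=> cnt B)) => [|a _]; last first.
  by apply: cnt_image => // x y _ _ [].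
by rewrite big_const_seq count_predT iter_addn_0 mulnC.
Qed.

End Counting.

(** * Ideals and the zeta function *)

Section Embeddings.
Variable R : realType.
Local Notation s2 := (Num.sqrt (2 : R)).

Definition sig (x : zs2) : R := (rpart x)%:~R + (ipart x)%:~R * s2.
Definition sigb (x : zs2) : R := (rpart x)%:~R - (ipart x)%:~R * s2.

Lemma sigD x y : sig (x + y) = sig x + sig y.
Proof. by rewrite /sig !partE !rmorphD /=; ring. Qed.
Lemma sigbD x y : sigb (x + y) = sigb x + sigb y.
Proof. by rewrite /sigb !partE !rmorphD /=; ring. Qed.
Lemma sigN x : sig (- x) = - sig x.
Proof. by rewrite /sig !partE !rmorphN /=; ring. Qed.
Lemma sigbN x : sigb (- x) = - sigb x.
Proof. by rewrite /sigb !partE !rmorphN /=; ring. Qed.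
Lemma sigB x y : sig (x - y) = sig x - sig y.
Proof. by rewrite sigD sigN. Qed.
Lemma sigbB x y : sigb (x - y) = sigb x - sigb y.
Proof. by rewrite sigbD sigbN. Qed.
Lemma sig0 : sig 0 = 0. Proof. by rewrite /sig mul0r addr0. Qed.
Lemma sig1 : sig 1 = 1. Proof. by rewrite /sig mul0r addr0. Qed.
Lemma sigb1 : sigb 1 = 1. Proof. by rewrite /sigb mul0r subr0. Qed.

Lemma intr2 : 2%:~R = s2 ^+ 2.
Proof. by rewrite sqrt2_sqr. Qed.

Lemma sigM x y : sig (x * y) = sig x * sig y.
Proof.
rewrite /sig !partE !rmorphD /= !rmorphM /=; rewrite intr2; ring.
Qed.
Lemma sigbM x y : sigb (x * y) = sigb x * sigb y.
Proof.
rewrite /sigb !partE !rmorphD /= !rmorphM /=; rewrite intr2; ring.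
Qed.

Lemma sig_sigb x : sig x * sigb x = (nrm x)%:~R.
Proof.
rewrite /sig /sigb /nrm !rmorphB /= !rmorphM /=.
by rewrite intr2; ring.
Qed.

Lemma sig_ratr x : sig x = ratr (rpart x)%:~R + ratr (ipart x)%:~R * s2.
Proof. by rewrite !ratr_int. Qed.

Lemma sig_inj : injective sig.
Proof.
move=> x y; rewrite !sig_ratr => /ratr_sqrt2_inj[/intr_inj h1 /intr_inj h2].
exact: zs2_eqP.
Qed.

Lemma sig_eq0 x : (sig x == 0) = (x == 0).
Proof. by rewrite -[X in _ == X]sig0 (inj_eq sig_inj). Qed.

Lemma ring_of_integersE : ring_of_integers (Qsqrt2 R) = range sig.
Proof.
apply/seteqP; split=> [x [[p [q ->]] /integral_Qsqrt2[/intrP[a ->] /intrP[b ->]]]|_ [x _ <-]].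
  by exists (ZS2 a b); rewrite // sig_ratr.
split; first by exists (rpart x)%:~R, (ipart x)%:~R; rewrite sig_ratr.
have [n nE] : exists n, n = nrm x by exists (nrm x).
(* The characteristic polynomial of [x], built from its trace and norm. *)
exists ('X^2 - ((2 * rpart x) *: 'X - n%:P)).
  rewrite monicE lead_coefDl ?lead_coefXn // size_polyN size_polyXn.
  rewrite ltnS (leq_trans (size_polyD _ _)) // geq_max size_polyN.
  rewrite (leq_trans (size_scale_leq _ _)) ?size_polyX //=.
  by rewrite (leq_trans (size_polyC_leq1 _)).
rewrite /root !rmorphB /= map_polyXn map_polyZ /= map_polyX map_polyC /= !hornerE /=.
rewrite nE -sig_sigb /sig /sigb rmorphM /=; apply/eqP; ring.
Qed.

Lemma conjK_sig x : conjK (sig x) = sigb x.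
Proof.
apply: xget_unique.
  by exists (rpart x)%:~R, (ipart x)%:~R; rewrite /sig /sigb !ratr_int.
move=> y [p [q [+ ->]]]; rewrite sig_ratr => /ratr_sqrt2_inj[<- <-].
by rewrite !ratr_int.
Qed.

Definition pideal (g : zs2) : set R := [set sig (y * g) | y in setT].

Lemma pideal_nonzero g : g != 0 -> nonzero_ideal (ring_of_integers (Qsqrt2 R)) (pideal g).
Proof.
move=> g0; rewrite ring_of_integersE; split; last first.
  by exists (sig g); [exists 1; rewrite ?mul1r|rewrite sig_eq0].
split.
- by move=> _ [y _ <-]; exists (y * g).
- by exists 0; rewrite // mul0r sig0.
- by move=> _ _ [y _ <-] [z _ <-]; exists (y + z); rewrite // mulrDl sigD.
- by move=> _ _ [y _ <-] [z _ <-]; exists (y * z); rewrite // -mulrA sigM.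
Qed.

Lemma nonzero_idealP I : nonzero_ideal (ring_of_integers (Qsqrt2 R)) I ->
  exists2 g, reduced g & I = pideal g.
Proof.
rewrite ring_of_integersE => -[[IO I0 ID IM] [x0 Ix0 x0n0]].
have [x Ex] : exists x, x0 = sig x by have [x _ <-] := IO _ Ix0; exists x.
have [||| g g0 Ig] := @zs2_principal (fun z => I (sig z)).
- by move=> *; rewrite sigD; exact: ID.
- by move=> *; rewrite sigM; apply: IM => //; eexists.
- by exists x; [rewrite -Ex|rewrite -sig_eq0 -Ex].
have [u uu Gu] := reduced_exists g0.
exists (u * g) => //; apply/seteqP; split=> [z Iz|_ [y _ <-]].
  have [w _ Ew] := IO _ Iz; move: Iz; rewrite -Ew => /Ig[y ->].
  by exists (y * u^-1); rewrite // mulrA divrK.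
by apply/Ig; exists (y * u); rewrite mulrA.
Qed.

Lemma pideal_inj : {in [set g | reduced g] &, injective pideal}.
Proof.
move=> g h; rewrite !inE => Gg Gh E.
have n0 x : reduced x -> x != 0 by move/reduced_nrm_gt0/lt0r_neq0; rewrite nrm_eq0.
have [y _ /sig_inj Ey] : pideal h (sig g) by rewrite -E; exists 1; rewrite ?mul1r.
have [z _ /sig_inj Ez] : pideal g (sig h) by rewrite E; exists 1; rewrite ?mul1r.
have yz : y * z = 1.
  by apply: (mulIf (n0 _ Gg)); rewrite -mulrA Ez Ey mul1r.
have uy : y \is a GRing.unit by apply/unitrP; exists z; rewrite mulrC.
by rewrite -Ey (reduced_unique Gh uy) ?mul1r// Ey.
Qed.
End Embeddings.
Arguments sig R x : clear implicits.
Arguments sigb R x : clear implicits.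
Arguments pideal R g : clear implicits.

(* The Hermite normal form of the lattice [g Z[sqrt 2]], of which [(m, 0)] and
   [(c, d)] form a basis. *)
Lemma ideal_hnf g : reduced g ->
  exists (m d : nat) (c : int), [/\ [/\ (m * d)%N = `|nrm g|%N, (0 < m)%N & (0 < d)%N],
    exists y, ZS2 m 0 = y * g, exists y, ZS2 c d = y * g
    & (forall y, (d %| ipart (y * g))%Z) /\
      (forall y, ipart (y * g) = 0 -> (m %| rpart (y * g))%Z)].
Proof.
move=> Gg; have n0 := reduced_nrm_gt0 Gg; have a1 : 1 <= rpart g by case/and3P: Gg.
set a := rpart g in a1; set b := ipart g.
have [u [v E]] := Bezoutz a b.
have [d dE] : exists d : nat, gcdz a b = d by exists `|gcdz a b|%N; rewrite gez0_abs.
have /dvdzP[a' aE] : (d%:Z %| a)%Z by rewrite -dE dvdz_gcdl.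
have /dvdzP[b' bE] : (d%:Z %| b)%Z by rewrite -dE dvdz_gcdr.
have d0 : (0 < d)%N by rewrite lt0n; apply/eqP => d0; move: aE a1; rewrite d0; lia.
have uv1 : u * a' + v * b' = 1.
  apply: (@mulIf _ d%:Z); first by lia.
  by rewrite mul1r -[RHS]dE -E aE bE; ring.
(* With g = a + b sqrt 2 and d = gcd(a, b), the least positive integer of the ideal is N(g) / d, the
   product of g and g' / d. *)
pose m := a * a' - 2 * b * b'.
have mE : m * d = nrm g.
  transitivity (a * (a' * d) - 2 * b * (b' * d)); first by rewrite /m; ring.
  by rewrite -aE -bE /nrm -/a -/b; ring.
have m0 : 0 < m by move: n0; rewrite -mE; nia.
exists `|m|%N, d, (rpart (ZS2 v u * g)); split => //.
- by split=> //; [rewrite -mE abszM|rewrite absz_gt0 gt_eqF].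
- exists (ZS2 a' (- b')); rewrite gtz0_abs//.
  by apply: zs2_eqP; rewrite !partE /= -/a -/b /m ?aE ?bE; ring.
- exists (ZS2 v u); apply: zs2_eqP => //.
  by rewrite !partE /= -/a -/b -dE -E; ring.
split=> y; rewrite !partE -/a -/b.
  by rewrite aE bE; apply/dvdzP; exists (rpart y * b' + ipart y * a'); ring.
(* A vanishing irrational part makes [y] a multiple of g' / d; the Bezout coefficients exhibit the
   factor. *)
set s := rpart y; set t := ipart y => E0.
have E1 : s * b' + t * a' = 0.
  apply: (@mulIf _ d%:Z); first by lia.
  by rewrite mul0r -E0 aE bE; ring.
rewrite gtz0_abs//; apply/dvdzP; exists (- (v * t - u * s)).
have tE : t = b' * (v * t - u * s).
  apply: subr0_eq.
  have -> : t - b' * (v * t - u * s) =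
    (1 - (u * a' + v * b')) * t + u * (s * b' + t * a') by ring.
  by rewrite uv1 E1; ring.
have sE : s = - a' * (v * t - u * s).
  apply: subr0_eq.
  have -> : s - - a' * (v * t - u * s) =
    (1 - (u * a' + v * b')) * s + v * (s * b' + t * a') by ring.
  by rewrite uv1 E1; ring.
by rewrite {1}tE {1}sE /m; ring.
Qed.

(** Each coset has exactly one representative i + j sqrt 2 with i < m and j < d: subtracting
    multiples of (c, d) normalizes the irrational part, then multiples of (m, 0) the rational
    part. *)
Lemma ideal_norm_pideal (R : realType) g : reduced g ->
  ideal_norm (ring_of_integers (Qsqrt2 R)) (pideal R g) = `|nrm g|%N.
Proof.
move=> Gg; have [m [d [c [[mdE m0 d0] [ym ymE] [yd ydE] [dvdd dvdm]]]]] := ideal_hnf Gg.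
rewrite -mdE /ideal_norm ring_of_integersE.
pose O : set R := range (sig R).
pose co (z : zs2) : set R := [set sig R z + y | y in pideal R g].
have coE z w : co z = co w <-> exists y, z - w = y * g.
  split=> [E|[y E]].
    have [_ [y _ <-]] : co w (sig R z).
      by rewrite -E; exists 0; rewrite ?addr0//; exists 0; rewrite // mul0r sig0.
    rewrite -sigD => /sig_inj <-; exists y; ring.
  have zE : z = w + y * g by rewrite -E; ring.
  apply/seteqP; split=> _ [_ [y' _ <-] <-]; rewrite -sigD.
    exists (sig R (y * g + y' * g)); last by rewrite -sigD zE addrA.
    by exists (y + y'); rewrite // mulrDl.
  exists (sig R (- (y * g) + y' * g)); last by rewrite -sigD zE; congr (sig _ _); ring.
  by exists (- y + y'); rewrite // mulrDl mulNr.
pose rep (p : nat * nat) := co (ZS2 p.1 p.2).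
have -> : [set [set x + y | y in pideal R g] | x in O] = rep @` (`I_m `*` `I_d).
  apply/seteqP; split=> [_ [_ [z _ <-] <-]|_ [[i j] _ <-]]; last first.
    by exists (sig R (ZS2 i j)) => //; exists (ZS2 i j).
  pose q := (ipart z %/ d)%Z; pose z1 := z - ZS2 q 0 * ZS2 c d.
  pose q1 := (rpart z1 %/ m)%Z; pose z2 := z1 - ZS2 q1 0 * ZS2 m 0.
  have iz1 : ipart z1 = (ipart z %% d)%Z by rewrite /z1 !partE /= /modz -/q; ring.
  have iz2 : ipart z2 = (ipart z %% d)%Z by rewrite -iz1 /z2 !partE /=; ring.
  have rz2 : rpart z2 = (rpart z1 %% m)%Z by rewrite /z2 !partE /= /modz -/q1; ring.
  have dn0 : d%:Z != 0 by lia.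
  have mn0 : m%:Z != 0 by lia.
  have rlt : (`|rpart z2| < m)%N.
    by rewrite rz2; have := modz_ge0 (rpart z1) mn0; have := ltz_mod (rpart z1) mn0; lia.
  have ilt : (`|ipart z2| < d)%N.
    by rewrite iz2; have := modz_ge0 (ipart z) dn0; have := ltz_mod (ipart z) dn0; lia.
  exists (`|rpart z2|%N, `|ipart z2|%N); first by [].
  apply/coE; exists (- (ZS2 q 0 * yd + ZS2 q1 0 * ym)).
  have -> : ZS2 `|rpart z2|%N `|ipart z2|%N = z2.
    apply: zs2_eqP; rewrite [LHS]gez0_abs// ?rz2 ?iz2; exact: modz_ge0.
  by rewrite /z2 /z1 ydE ymE; ring.
have := @cnt_image _ _ rep (`I_m `*` `I_d); rewrite /cnt => ->.
- by rewrite -[LHS]/(cnt _) cntX ?cnt_II//; exact: finite_II.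
- by apply: finite_setX; exact: finite_II.
have small (k e x y : int) : 0 <= x < e -> 0 <= y < e -> x - y = k * e -> x = y.
  move=> /andP[x0 xe] /andP[y0 ye] E.
  have [k0|k0|k0] := ltgtP k 0; [| |by move: E; rewrite k0 mul0r => /subr0_eq].
    suff : k * e <= - e by lia.
    by rewrite -mulN1r ler_pM2r; lia.
  suff : e <= k * e by lia.
  by rewrite -[leLHS]mul1r ler_pM2r; lia.
move=> [i j] [i' j']; rewrite !inE => -[/= im jd] [/= i'm j'd] /coE[y yE].
have im1 : (i < m)%N := im.
have jd1 : (j < d)%N := jd.
have im2 : (i' < m)%N := i'm.
have jd2 : (j' < d)%N := j'd.
have jj : (j : int) = j'.
  have := dvdd y; rewrite -yE !partE /= => /dvdzP[k]; apply: small; lia.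
have := dvdm y; rewrite -yE !partE /= jj subrr => /(_ erefl)/dvdzP[k kE].
have ii : (i : int) = i'.
  by apply: small kE; lia.
by case: ii => ->; case: jj => ->.
Qed.

(** The term of the zeta series at 2 for the ideal generated by [g]. *)
Definition wt (R : realType) (g : zs2) : R := ((nrm g)%:~R ^+ 2)^-1.

Lemma dedekind_zetaE (R : realType) :
  dedekind_zeta (Qsqrt2 R) 2 = fine (\esum_(g in [set g | reduced g]) (wt R g)%:E).
Proof.
rewrite /dedekind_zeta; congr fine.
have -> : [set I | nonzero_ideal (ring_of_integers (Qsqrt2 R)) I] =
    pideal R @` [set g | reduced g].
  apply/seteqP; split=> [I /nonzero_idealP[g Gg ->]|_ [g Gg <-]]; first by exists g.
  by apply: pideal_nonzero; rewrite -nrm_eq0 gt_eqF//; exact: reduced_nrm_gt0.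
rewrite esum_image; last exact: pideal_inj.
apply: eq_esum => g Gg; rewrite ideal_norm_pideal// powRN powR_mulrn// /wt.
by rewrite natr_absz gtr0_norm// reduced_nrm_gt0.
Qed.

Lemma sum_uniq_sub (R : numDomainType) (T : eqType) (s L : seq T) (f : T -> R) :
  uniq s -> {subset s <= L} -> (forall x, 0 <= f x) ->
  \sum_(x <- s) f x <= \sum_(x <- L) f x.
Proof.
move=> + + f0; elim: s L => [|x s IH] L /=.
  by move=> _ _; rewrite big_nil sumr_ge0.
move=> /andP[xs us] sL; have xL : x \in L by apply: sL; rewrite mem_head.
rewrite big_cons (perm_big _ (perm_to_rem xL)) big_cons lerD2l; apply: IH => // y ys.
have yL : y \in L by apply: sL; rewrite inE ys orbT.
have := perm_mem (perm_to_rem xL) y; rewrite yL inE => /esym/orP[/eqP yx|//].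
by rewrite -yx ys in xs.
Qed.

(** * Numerical bounds for zeta_K(2) *)

Section Zeta.
Variable R : realType.
Local Notation wt := (wt R).

Lemma wt_ge0 g : 0 <= wt g.
Proof. by rewrite invr_ge0 sqr_ge0. Qed.

(** For g = a + b sqrt 2 reduced, |b| <= a / 2, so N(g) = a^2 - 2 b^2 >= a^2 / 2. *)
Lemma wt_bound g : reduced g -> wt g <= 4 / (rpart g)%:~R ^+ 4.
Proof.
move=> Gg; have n0 := reduced_nrm_gt0 Gg; case/and3P: Gg => h1 h2 h3.
have : rpart g ^+ 2 <= 2 * nrm g by rewrite /nrm; nia.
rewrite /wt; set n := nrm g in n0 *; set a := rpart g in h1 * => h.
have nR : 0 < n%:~R :> R by rewrite ltr0z.
have aR : 0 < a%:~R :> R by rewrite ltr0z; lia.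
have hR : a%:~R ^+ 2 <= 2 * n%:~R :> R.
  by rewrite -(ler_int R) rmorphXn rmorphM /= in h.
rewrite -invf_div lef_pV2 ?posrE ?exprn_gt0 ?divr_gt0 ?exprn_gt0 //.
rewrite ler_pdivrMr // (_ : a%:~R ^+ 4 = (a%:~R ^+ 2) ^+ 2); last by rewrite -exprM.
rewrite (_ : _ * 4 = (2 * n%:~R) ^+ 2); last by ring.
by rewrite ler_pXn2r ?nnegrE ?sqr_ge0 // mulr_ge0 // ltW.
Qed.

(* The term [a = 2] is [1/2]; from [a = 3] on, [4 / a^3] is at most the
   telescoping term [4 / ((a - 1) a (a + 1))]. *)
Lemma sum_cube_bound n : \sum_(a <- iota 2 n) (4 / a%:R ^+ 3 : R) <= 5 / 6.
Proof.
(* The subtracted term is the tail of the telescoping majorant; it makes the induction go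
   through. *)
suff: \sum_(a <- iota 2 n.+1) (4 / a%:R ^+ 3 : R) <= 5 / 6 - 2 / ((n.+2)%:R * (n.+3)%:R).
  move=> H; apply: (@le_trans _ _ (5 / 6 - 2 / ((n.+2)%:R * (n.+3)%:R))); last first.
    by rewrite lerBlDr lerDl divr_ge0.
  apply: le_trans H; rewrite -[n.+1]addn1 iotaD big_cat /= lerDl big_seq1.
  by rewrite divr_ge0 // exprn_ge0.
elim: n => [|n IH]; first by rewrite big_seq1; lra.
have -> : iota 2 n.+2 = iota 2 n.+1 ++ [:: n.+3] by rewrite -[n.+2 in LHS]addn1 iotaD.
rewrite big_cat /= big_seq1.
apply: le_trans (lerD IH (lexx _)) _.
rewrite -addrA lerD2l; set x : R := (n.+3)%:R.
have -> : (n.+2)%:R = x - 1 by rewrite /x -[n.+3]addn1 natrD addrK.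
have -> : (n.+4)%:R = x + 1 by rewrite /x -[n.+4]addn1 natrD.
have x3 : 3 <= x by rewrite /x ler_nat.
clearbody x.
have [xp xm x0] : [/\ x + 1 != 0, x - 1 != 0 & x != 0].
  by split; rewrite gt_eqF//; lra.
rewrite -subr_ge0.
have -> : - (2 / (x * (x + 1))) - (- (2 / ((x - 1) * x)) + 4 / x ^+ 3)
    = 4 / (x ^+ 3 * (x ^+ 2 - 1)).
  have xx : x ^+ 2 - 1 != 0 by rewrite -[1 in X in X != 0](expr1n _ 2) subr_sqr mulf_neq0.
  by field; rewrite ?x0 ?xp ?xm ?xx.
rewrite divr_ge0 // mulr_ge0 //; [rewrite exprn_ge0 //; lra|nra].
Qed.

(** A reduced element of rational part a has one of a possible irrational parts, as -a < 2 b <= a,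
    so these elements contribute at most a (4 / a^4) = 4 / a^3. The value a = 1 occurs only for g =
    1. *)
Lemma sum_wt_bound (s : seq zs2) : uniq s -> (forall g, g \in s -> reduced g /\ g != 1) ->
  \sum_(g <- s) wt g <= 5 / 6.
Proof.
move=> us sG.
pose n := (\max_(g <- s) `|rpart g|%N).
(* For k < a this runs through the integers b with -a < 2 b <= a, the smallest being minus the
   integer part of (a - 1) / 2. *)
pose mk (a k : nat) := ZS2 a (k%:Z - ((a.-1)./2)%:Z).
pose L := [seq mk a k | a <- iota 2 n, k <- iota 0 a].
pose f (g : zs2) : R := 4 / (rpart g)%:~R ^+ 4.
have f0 g : 0 <= f g by rewrite divr_ge0 // exprn_even_ge0.
apply: (@le_trans _ _ (\sum_(g <- s) f g)).
  by rewrite !big_seq; apply: ler_sum => g /sG[Gg _]; exact: wt_bound.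
apply: (@le_trans _ _ (\sum_(g <- L) f g)).
  apply: sum_uniq_sub => // g gs; have [Gg g1] := sG _ gs.
  case/and3P: Gg => h1 h2 h3.
  have a2 : 2 <= rpart g.
    have [//|] := leP 2 (rpart g) => l; case/eqP: g1.
    by apply: zs2_eqP; rewrite partE; lia.
  have an : (`|rpart g| <= n)%N by rewrite /n (big_rem g gs) /= leq_maxl.
  apply/allpairsPdep; exists `|rpart g|%N, `|(ipart g + ((`|rpart g|%N.-1)./2)%:Z)%R|%N.
  split; [by rewrite mem_iota; lia|rewrite mem_iota; lia|].
  by apply: zs2_eqP => /=; lia.
rewrite big_allpairs_dep; apply: le_trans (sum_cube_bound n).
rewrite !big_seq; apply: ler_sum => a; rewrite mem_iota => /andP[a2 _].
rewrite (eq_bigr (fun=> 4 / a%:R ^+ 4)) => [|k _]; last by rewrite /f /=.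
rewrite big_const_seq count_predT iter_addr_0 size_iota -mulr_natr.
have a0 : a%:R != 0 :> R by rewrite pnatr_eq0; lia.
by rewrite le_eqVlt; apply/orP; left; apply/eqP; field.
Qed.

Let E := (\esum_(g in [set g | reduced g]) (wt g)%:E)%E.
Local Notation Z := (fine E).

Lemma wt1 : wt 1 = 1. Proof. by rewrite /wt nrm1 expr1n invr1. Qed.

Lemma sum_wt_bound2 (s : seq zs2) : uniq s -> {subset s <= reduced} ->
  \sum_(g <- s) wt g <= 11 / 6.
Proof.
move=> us sG; pose t := [seq x <- s | x != 1].
apply: (@le_trans _ _ (\sum_(g <- 1 :: t) wt g)).
  apply: sum_uniq_sub => [//|g gs|g]; last exact: wt_ge0.
  by rewrite inE mem_filter gs andbT; case: eqP.
rewrite big_cons wt1; suff : \sum_(i <- t) wt i <= 5 / 6 by lra.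
apply: sum_wt_bound; first exact: filter_uniq.
by move=> g; rewrite mem_filter => /andP[-> /sG].
Qed.

(** Convergence of the series, so that [fine] returns its true sum. *)
Lemma esum_fin : E \is a fin_num.
Proof.
rewrite ge0_fin_numE; last by apply: esum_ge0 => g _; rewrite lee_fin wt_ge0.
apply: (@le_lt_trans _ _ (11 / 6 : R)%:E); last by rewrite ltry.
apply: ge_ereal_sup => _ [A [fA AG] <-].
rewrite fsbig_finite// sumEFin lee_fin; apply: sum_wt_bound2 => [|g]; first exact: fset_uniq.
by rewrite in_fset_set// inE => /AG.
Qed.

Lemma sum_wt_le_zeta (F : {fset zs2}) : {subset F <= reduced} -> \sum_(g <- F) wt g <= Z.
Proof.
move=> FG; rewrite -lee_fin fineK ?esum_fin//; apply: ereal_sup_ubound.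
exists [set` F]; first by split; [exact: finite_fset|move=> g /= /FG].
by rewrite fsbig_finite ?finite_fset// set_fsetK sumEFin.
Qed.

Lemma zeta_approx (e : R) : 0 < e ->
  exists2 F : {fset zs2}, {subset F <= reduced} & Z - e < \sum_(g <- F) wt g.
Proof.
move=> e0; have [_ [A [fA AG] <-]] := ub_ereal_sup_adherent e0 esum_fin.
rewrite fsbig_finite// sumEFin -/E => h; exists (fset_set A).
  by move=> g; rewrite in_fset_set// inE => /AG.
by rewrite -lte_fin EFinB fineK// esum_fin.
Qed.

Lemma zeta_ge1 : 1 <= Z.
Proof.
have := @sum_wt_le_zeta [fset 1]%fset; rewrite big_seq_fset1 wt1; apply.
by move=> g; rewrite inE => /eqP->.
Qed.

End Zeta.

(** * Primitive vectors *)

Definition smul (g : zs2) (v : zs2 * zs2) : zs2 * zs2 := (g * v.1, g * v.2).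

(** Vectors are coordinates in a basis of M over O, so this is primitivity inside M: a common
    divisor g must satisfy v / g in M, which is more than v / g in O^2. *)
Definition prim (v : zs2 * zs2) := forall g w, v = smul g w -> g \is a GRing.unit.

Lemma smulA g h v : smul g (smul h v) = smul (g * h) v.
Proof. by rewrite /smul /= !mulrA. Qed.
Lemma smul1 v : smul 1 v = v.
Proof. by case: v => a b; rewrite /smul /= !mul1r. Qed.
Lemma smul_inj g : g != 0 -> injective (smul g).
Proof. move=> g0 [a b] [c d] E.
have E1 : g * a = g * c := congr1 fst E.
have E2 : g * b = g * d := congr1 snd E.
by rewrite (mulfI g0 E1) (mulfI g0 E2). Qed.
Lemma smul_eq0 g v : (smul g v == 0) = (g == 0) || (v == 0).
Proof.
case: v => a b; rewrite /smul -!pair_eqE /= /pair_eq /= !mulf_eq0.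
by case: (g == 0).
Qed.

Lemma reduced_neq0 g : reduced g -> g != 0.
Proof. by move/reduced_nrm_gt0/lt0r_neq0; rewrite nrm_eq0. Qed.

Lemma prim_neq0 v : prim v -> v != 0.
Proof.
move=> pv; apply/eqP => v0; have := pv 0 0; rewrite v0 /smul /= mulr0 => /(_ erefl).
by rewrite unitr0.
Qed.

Lemma dvd_nrm_le g x : g * x != 0 -> (`|nrm g| <= `|nrm (g * x)%R|)%N.
Proof.
rewrite nrmM abszM -nrm_eq0 nrmM mulf_eq0 negb_or => /andP[_ x0].
by rewrite leq_pmulr // absz_gt0.
Qed.

(** Take a common divisor of maximal norm: the norms of the common divisors are bounded by that of a
    nonzero coordinate. A unit then makes the divisor reduced. *)
Lemma prim_decomp v : v != 0 -> exists g w, [/\ reduced g, prim w & v = smul g w].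
Proof.
move=> v0.
have [g [w [vE wp]]] : exists g w, v = smul g w /\ prim w.
  have [B hB] : exists B, forall g w, v = smul g w -> (`|nrm g| <= B)%N.
    have : (v.1 != 0) || (v.2 != 0) by rewrite -negb_and; move: v0; case: (v).
    case/orP => vi; [exists `|nrm v.1|%N|exists `|nrm v.2|%N] => g w vE;
      by move: vi; rewrite vE; exact: dvd_nrm_le.
  (* [n] limits how often the divisor can still be enlarged, since every nonunit factor raises its
     norm. *)
  have [n ltn] : exists n, (B < n + `|nrm 1%R|)%N by exists B; rewrite nrm1 addn1.
  have : exists w, v = smul 1 w by exists v; rewrite smul1.
  move: ltn; move: (1 : zs2) => g; elim: n g => [|n IH] g ltn [w vE].
    by have := hB _ _ vE; rewrite leqNgt ltn.
  have [wp|] := pselect (prim w); first by exists g, w.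
  move=> /existsNP[h /existsNP[w' /not_implyP[wE /negP hu]]].
  have vE' : v = smul (g * h) w' by rewrite vE wE smulA.
  have gh0 : g * h != 0 by move: v0; rewrite vE' smul_eq0 => /norP[].
  apply: (IH (g * h)); last by exists w'.
  rewrite (leq_trans ltn)// addSn -addnS leq_add2l nrmM abszM.
  move: gh0; rewrite -nrm_eq0 nrmM mulf_eq0 => /norP[g0 h0].
  rewrite unit_nrm in hu.
  rewrite -absz_eq0 -lt0n in g0; rewrite -absz_eq0 -lt0n in h0.
  by move: hu g0 h0; move: `|nrm g|%N `|nrm h|%N => x y; nia.
have g0 : g != 0 by move: v0; rewrite vE smul_eq0 => /norP[].
have [u uu Gu] := reduced_exists g0.
exists (u * g), (smul u^-1 w); split=> //; last first.
  by rewrite smulA vE mulrAC mulrV// mul1r.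
move=> h w' E; apply: (wp h (smul u w')); rewrite smulA mulrC -smulA -E smulA mulrV//.
by rewrite smul1.
Qed.

(** Dividing [g] and [g'] by their gcd gives x w = y w' with x and y coprime. By Bezout, x divides
    w' and y divides w, so both are units; [g] and [g'] are then associate and reduced, hence
    equal. *)
Lemma prim_decomp_unique g g' w w' : reduced g -> reduced g' -> prim w -> prim w' ->
  smul g w = smul g' w' -> g = g' /\ w = w'.
Proof.
move=> Gg Gg' pw pw' E.
have [h [x [y [u [v [gE g'E h0 xy]]]]]] := zs2_bezout g' (reduced_neq0 Gg).
have E' : smul x w = smul y w'.
  by apply: (smul_inj h0); rewrite !smulA ![h * _]mulrC -gE -g'E.
have E1 : x * w.1 = y * w'.1 := congr1 fst E'.
have E2 : x * w.2 = y * w'.2 := congr1 snd E'.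
have ux : x \is a GRing.unit.
  apply: (pw' x (u * w'.1 + v * w.1, u * w'.2 + v * w.2)).
  rewrite /smul /=; rewrite [LHS](surjective_pairing w'); congr pair.
    by rewrite -[LHS]mul1r -xy mulrDr [x * (v * w.1)]mulrCA E1; ring.
  by rewrite -[LHS]mul1r -xy mulrDr [x * (v * w.2)]mulrCA E2; ring.
have uy : y \is a GRing.unit.
  apply: (pw y (u * w'.1 + v * w.1, u * w'.2 + v * w.2)).
  rewrite /smul /=; rewrite [LHS](surjective_pairing w); congr pair.
    by rewrite -[LHS]mul1r -xy mulrDr [y * (u * w'.1)]mulrCA -E1; ring.
  by rewrite -[LHS]mul1r -xy mulrDr [y * (u * w'.2)]mulrCA -E2; ring.
have gg : g = g'.
  have gE2 : g = (x / y) * g' by rewrite g'E gE mulrA divrK.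
  have uxy : x / y \is a GRing.unit by rewrite unitrM ux unitrV.
  have xy1 : x / y = 1 by apply: (reduced_unique Gg' uxy); rewrite -gE2.
  by rewrite gE2 xy1 mul1r.
by split=> //; apply: (smul_inj (reduced_neq0 Gg)); rewrite E gg.
Qed.

(** * The module M, its two embeddings and a uniform counting bound *)

Section Positions.
Variable R : realType.
Local Notation s2 := (Num.sqrt (2 : R)).
Local Notation sig := (sig R).
Local Notation sigb := (sigb R).

Definition rt2 := ZS2 0 1.

Lemma sig_rt2 : sig rt2 = s2. Proof. by rewrite /sig /= add0r mul1r. Qed.

(* [(1, 1)] and [(0, sqrt 2)] form a basis of the module of the vectors
   [x] of O^2 such that [x.1 - x.2] is divisible by sqrt 2. *)
Definition pos (v : zs2 * zs2) : R * R := (sig v.1, sig (v.1 + rt2 * v.2)).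
Definition star (v : zs2 * zs2) : R * R := (sigb v.1, sigb (v.1 + rt2 * v.2)).

Lemma pos_smul g v : pos (smul g v) = sig g *: pos v.
Proof. by rewrite /pos /smul /= mulrCA -mulrDr !sigM. Qed.
Lemma star_smul g v : star (smul g v) = sigb g *: star v.
Proof. by rewrite /star /smul /= mulrCA -mulrDr !sigbM. Qed.

Lemma rt2_neq0 : rt2 != 0. Proof. by []. Qed.

Lemma basis_inj : injective (fun v : zs2 * zs2 => (v.1, v.1 + rt2 * v.2)).
Proof.
move=> [a b] [c d] /= E; have E1 : a = c := congr1 fst E.
have E2 : a + rt2 * b = c + rt2 * d := congr1 snd E.
by move: E2; rewrite E1 => /addrI/(mulfI rt2_neq0)->.
Qed.

Lemma pos_inj : injective pos.
Proof.
move=> v w E; apply: basis_inj; congr pair; first exact: sig_inj (congr1 fst E).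
exact: sig_inj (congr1 snd E).
Qed.

Lemma nrm_ge1 x : x != 0 -> 1 <= `|sig x| * `|sigb x|.
Proof.
move=> x0; rewrite -normrM sig_sigb -intr_norm ler1z.
by rewrite -gtz0_ge1 normr_gt0 nrm_eq0.
Qed.

Definition zbox (u w : R) := [set x : zs2 | `|sig x| <= u /\ `|sigb x| <= w].

(* The values of [sig] on [zbox u w] are at least [1 / (2 w)] apart, since the
   norm of a nonzero element is at least 1. *)
Lemma zbox_cnt u w : 0 < u -> 0 < w -> finite_set (zbox u w) /\
  (cnt (zbox u w))%:R <= 4 * u * w + 1.
Proof.
move=> u0 w0; pose m := 2 * w; have m0 : 0 < m by rewrite mulr_gt0.
pose f (x : zs2) := `|Num.floor (m * (sig x + u))|%N.
pose N := `|Num.floor (m * (2 * u))|%N.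
have fge0 x : zbox u w x -> 0 <= Num.floor (m * (sig x + u)).
  by move=> [/ler_normlP[h1 h2] _]; rewrite floor_ge0 mulr_ge0 ?(ltW m0)//; lra.
have [||fin le] := @inj_finite_cnt _ _ f (zbox u w) `I_N.+1 (finite_II _).
- move=> x y; rewrite !inE => zx zy /(congr1 Posz); rewrite /f !gez0_abs ?fge0// => E.
  apply/eqP/negPn/negP => xy.
  have : x - y != 0 by rewrite subr_eq0.
  move/nrm_ge1; rewrite sigB sigbB leNgt => /negP; apply.
  have := floor_itv (m * (sig x + u)); have := floor_itv (m * (sig y + u)).
  rewrite E; set k := (Num.floor _)%:~R => /andP[y1 y2] /andP[x1 x2].
  have h1 : m * `|sig x - sig y| < 1.
    rewrite -[m in X in X < _](ger0_norm (ltW m0)) -normrM ltr_norml; apply/andP; split; lra.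
  have h2 : `|sigb x - sigb y| <= m.
    have [_ bx] := zx; have [_ yb] := zy.
    by apply: (le_trans (ler_normB _ _)); rewrite /m; lra.
  apply: le_lt_trans h1; rewrite mulrC; exact: ler_wpM2r.
- move=> x zx; have a0 := fge0 x zx.
  have : Num.floor (m * (sig x + u)) <= Num.floor (m * (2 * u)).
    by apply: le_floor; rewrite ler_pM2l//; have [/ler_normlP[h1 h2] _] := zx; lra.
  by rewrite /= ltnS /f /N; lia.
split=> //; rewrite cnt_II in le.
apply: (@le_trans _ _ (N.+1)%:R); first by rewrite ler_nat.
have mu0 : 0 <= m * (2 * u) by rewrite !mulr_ge0 ?ltW.
rewrite -natr1 lerD2r /N natr_absz ger0_norm ?floor_ge0//.
apply: le_trans (floor_le _) _; rewrite /m; lra.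
Qed.

Definition vbox (u w : R) := [set v | [/\ v != 0, zbox u w v.1 & zbox u w (v.1 + rt2 * v.2)]].

(** If u w < 1 there is no vector at all, since a nonzero element of [zbox u w] would have norm
    below 1 in absolute value; otherwise 4 u w + 1 <= 5 u w. This removes the additive term, so the
    bound can be summed over all g. *)
Lemma vbox_cnt u w : 0 < u -> 0 < w -> finite_set (vbox u w) /\
  (cnt (vbox u w))%:R <= 25 * (u * w) ^+ 2.
Proof.
move=> u0 w0; have [zf zle] := zbox_cnt u0 w0.
have [||fin le] := @inj_finite_cnt _ _ (fun v : zs2 * zs2 => (v.1, v.1 + rt2 * v.2))
   (vbox u w) (zbox u w `*` zbox u w) (finite_setX zf zf).
- by move=> x y _ _; exact: basis_inj.
- by move=> v [_ h1 h2].
split=> //; rewrite cntX// in le.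
have [uw|uw] := ltP (u * w) 1.
  have -> : vbox u w = set0.
    apply/seteqP; split=> // v [v0 h1 h2].
    have aux x : zbox u w x -> x = 0.
      move=> [hx hx']; apply/eqP/negPn/negP => /nrm_ge1; rewrite leNgt => /negP; apply.
      by apply: le_lt_trans uw; apply: ler_pM.
    move: v0; apply/negP; rewrite negbK; apply/eqP; apply: basis_inj => /=.
    by rewrite (aux _ h2) (aux _ h1); congr pair; rewrite mulr0 addr0.
  by rewrite cnt0 mulr_ge0 ?sqr_ge0.
apply: (@le_trans _ _ ((cnt (zbox u w) * cnt (zbox u w))%N)%:R); first by rewrite ler_nat.
rewrite natrM -expr2 (_ : 25 * (u * w) ^+ 2 = (5 * (u * w)) ^+ 2); last by ring.
rewrite ler_pXn2r ?nnegrE//; first lra.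
by rewrite !mulr_ge0 ?ltW.
Qed.

End Positions.

Section Dilate.
Variable R : realType.
Implicit Types D : set (R * R).

Lemma dilateP r D x : r != 0 -> dilate r D x <-> D (r^-1 *: x).
Proof.
move=> r0; split=> [[y Dy <-]|Dx]; first by rewrite scalerA mulVf// scale1r.
by exists (r^-1 *: x) => //; rewrite scalerA mulfV// scale1r.
Qed.

Lemma dilate_scale r s D x : s != 0 -> r != 0 -> dilate r D (s *: x) <-> dilate (r / s) D x.
Proof.
move=> s0 r0; rewrite !dilateP ?mulf_neq0 ?invr_eq0// scalerA invfM invrK.
by rewrite mulrC.
Qed.

Lemma bounded_set_box D : bounded_set D ->
  exists2 k : R, 0 < k & forall x, D x -> `|x.1| <= k /\ `|x.2| <= k.
Proof.
move=> /ex_strict_bound_gt0[k k0 kD]; exists k => // x Dx.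
have /ltW := kD _ Dx; rewrite prod_normE ge_max => /andP[h1 h2].
by split.
Qed.

Lemma near_pinfty_div (c : R) (P : R -> Prop) : 0 < c ->
  (\forall r \near +oo, P r) -> \forall r \near +oo, P (r / c).
Proof.
move=> c0 [M [Mr HM]]; exists (M * c); split; first exact: num_real.
by move=> x Mx; apply: HM; rewrite ltr_pdivlMr.
Qed.

Lemma near_pinfty_seq (T : eqType) (s : seq T) (P : T -> R -> Prop) :
  (forall g, g \in s -> \forall r \near +oo, P g r) ->
  \forall r \near +oo, forall g, g \in s -> P g r.
Proof.
elim: s => [|g s IH] H; first by near=> r => g.
have H1 := H g (mem_head _ _).
have H2 : \forall r \near +oo, forall h, h \in s -> P h r.
  by apply: IH => h hs; apply: H; rewrite inE hs orbT.
near=> r => h; rewrite inE => /orP[/eqP->|]; first by near: r.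
by move: h; near: r.
Unshelve. all: by end_near.
Qed.

End Dilate.

(** * Splitting the nonzero vectors by their reduced divisors *)

Section Decomposition.
Variable R : realType.
Variables D W : set (R * R).
Hypotheses (bD : bounded_set D) (bW : bounded_set W).
Local Notation sig := (sig R).
Local Notation sigb := (sigb R).
Local Notation pos := (@pos R).
Local Notation star := (@star R).
Local Notation wt := (wt R).

Definition nonzeros r l := [set v | [/\ v != 0, dilate r D (pos v) & dilate l W (star v)]].
Definition prims r l := [set v | [/\ prim v, dilate r D (pos v) & dilate l W (star v)]].

Lemma prims_sub r l : prims r l `<=` nonzeros r l.
Proof. by move=> v [/prim_neq0 v0 h1 h2]. Qed.

Lemma nonzeros_bound : exists2 B : R, 0 < B & forall r l, 0 < r -> 0 < l ->
  finite_set (nonzeros r l) /\ (cnt (nonzeros r l))%:R <= B * (r * l) ^+ 2.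
Proof.
have [k k0 kD] := bounded_set_box bD; have [m m0 mW] := bounded_set_box bW.
exists (25 * (k * m) ^+ 2) => [|r l r0 l0].
  by rewrite mulr_gt0// exprn_gt0// mulr_gt0.
have sub : nonzeros r l `<=` vbox (r * k) (l * m).
  move=> v [v0 [x Dx xE] [y Wy yE]].
  have [x1 x2] := kD _ Dx; have [y1 y2] := mW _ Wy.
  have E1 : sig v.1 = r * x.1 by rewrite -[LHS]/(pos v).1 -xE.
  have E2 : sig (v.1 + rt2 * v.2) = r * x.2 by rewrite -[LHS]/(pos v).2 -xE.
  have E3 : sigb v.1 = l * y.1 by rewrite -[LHS]/(star v).1 -yE.
  have E4 : sigb (v.1 + rt2 * v.2) = l * y.2 by rewrite -[LHS]/(star v).2 -yE.
  split=> //; split; rewrite ?E1 ?E2 ?E3 ?E4 normrM gtr0_norm// ler_pM2l//.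
have [fv cv] := vbox_cnt (mulr_gt0 r0 k0) (mulr_gt0 l0 m0).
split; first exact: sub_finite_set sub fv.
apply: le_trans (_ : (cnt (vbox (r * k) (l * m)))%:R <= _).
  by rewrite ler_nat; exact: cnt_le.
by apply: le_trans cv _; rewrite le_eqVlt; apply/orP; left; apply/eqP; ring.
Qed.

Lemma reduced_sig_gt0 g : reduced g -> 0 < sig g /\ 0 < sigb g.
Proof.
move=> /and3P[h1 h2 h3]; have /andP[s1 s2] := sqrt2_bounds R.
have a1 : 1 <= (rpart g)%:~R :> R by rewrite ler1z.
have a2 : - (rpart g)%:~R < 2 * (ipart g)%:~R :> R
  by rewrite -(ltr_int R) rmorphM rmorphN in h2.
have a3 : 2 * (ipart g)%:~R <= (rpart g)%:~R :> R by rewrite -(ler_int R) rmorphM in h3.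
by rewrite /sig /sigb; split; nra.
Qed.

(** The prescribed [s] holds the divisors to be treated by limits; [t] collects the finitely many
    others that occur, and varies with [r] and [l]. *)
Lemma nonzeros_decomp r l (s : seq zs2) : 0 < r -> 0 < l ->
  uniq s -> {subset s <= reduced} ->
  exists t, [/\ uniq (s ++ t), {subset t <= reduced} &
    cnt (nonzeros r l) = (\sum_(g <- s ++ t) cnt (prims (r / sig g) (l / sigb g)))%N].
Proof.
move=> r0 l0 us sG.
have [B B0 HB] := nonzeros_bound.
have [fN _] := HB _ _ r0 l0.
(* The default 1 concerns only v = 0, since every nonzero vector has a decomposition. *)
pose gof v := xget 1 [set g | reduced g /\ exists2 w, prim w & v = smul g w].
have gofP v : v != 0 -> reduced (gof v) /\ exists2 w, prim w & v = smul (gof v) w.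
  move=> /prim_decomp[g [w [Gg pw vE]]].
  apply: (@xgetI _ 1 [set g | reduced g /\ exists2 w, prim w & v = smul g w] g).
  by split => //; exists w.
pose H := fset_set (gof @` nonzeros r l).
have fH : finite_set (gof @` nonzeros r l) by exact: finite_image.
pose t := [seq g <- H | g \notin s].
have tG : {subset t <= reduced}.
  move=> g; rewrite mem_filter => /andP[_]; rewrite in_fset_set// inE => -[v [v0 _ _] <-].
  by have [] := gofP _ v0.
have ust : uniq (s ++ t).
  rewrite cat_uniq us filter_uniq ?fset_uniq// andbT /=; apply/hasPn => g.
  by rewrite mem_filter => /andP[].
exists t; split=> //.
have stG g : g \in s ++ t -> reduced g by rewrite mem_cat => /orP[/sG|/tG].
pose F g := smul g @` prims (r / sig g) (l / sigb g).
have fP g : reduced g -> finite_set (prims (r / sig g) (l / sigb g)).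
  move=> /reduced_sig_gt0[p1 p2]; apply: sub_finite_set (@prims_sub _ _) _.
  by have [] := HB (r / sig g) (l / sigb g) (divr_gt0 r0 p1) (divr_gt0 l0 p2).
have memF g w : reduced g ->
    prims (r / sig g) (l / sigb g) w <->
    prim w /\ dilate r D (pos (smul g w)) /\ dilate l W (star (smul g w)).
  move=> /reduced_sig_gt0[p1 p2]; rewrite pos_smul star_smul.
  have p1' := lt0r_neq0 p1; have p2' := lt0r_neq0 p2.
  have r0' := lt0r_neq0 r0; have l0' := lt0r_neq0 l0.
  split=> [[pw /(dilate_scale _ _ p1' r0') h1 /(dilate_scale _ _ p2' l0') h2]|[pw [h1 h2]]] //.
  by split=> //; apply/dilate_scale.
have -> : nonzeros r l = \bigcup_(g in [set` s ++ t]) F g.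
  apply/seteqP; split=> [v Nv|v [g gst [w Pw <-]]].
    have [v0 vD vW] := Nv; have [Gg [w pw vE]] := gofP _ v0.
    exists (gof v).
      rewrite /= mem_cat mem_filter in_fset_set//.
      case: (boolP (_ \in s)) => //= _; rewrite inE; by exists v.
    by exists w => //; apply/memF => //; rewrite -vE.
  have Gg := stG _ gst; have [pw [h1 h2]] := (memF _ _ Gg).1 Pw.
  by split => //; rewrite smul_eq0 negb_or reduced_neq0// prim_neq0.
have [||_ ->] := @cnt_bigcup _ _ (s ++ t) F ust.
- by move=> g gst; apply: finite_image; exact/fP/stG.
- move=> g h v gst hst [w Pw <-] [w' Pw' E].
  have [pw _] := (memF _ _ (stG _ gst)).1 Pw.
  have [pw' _] := (memF _ _ (stG _ hst)).1 Pw'.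
  by have [] := prim_decomp_unique (stG _ hst) (stG _ gst) pw' pw E.
rewrite !big_seq; apply: eq_bigr => g gst; rewrite cnt_image//; first exact/fP/stG.
by move=> x y _ _; apply: smul_inj; exact/reduced_neq0/stG.
Qed.
End Decomposition.

(** * Density of primitive vectors *)

Section Contraction.
Variable R : realType.
Variables D W : set (R * R).
Hypotheses (bD : bounded_set D) (bW : bounded_set W).
Local Notation sig := (sig R).
Local Notation sigb := (sigb R).
Local Notation wt := (wt R).
Local Notation nonzeros := (nonzeros D W).
Local Notation prims := (prims D W).
Local Notation Z := (fine (\esum_(g in [set g | reduced g]) (wt g)%:E)).
Variable C : R.
Hypothesis C0 : 0 <= C.
Hypothesis nonzerosC : forall l, 0 < l ->
  (cnt (nonzeros r l))%:R / (r * l) ^+ 2 @[r --> +oo] --> C.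

Let kap := C / Z.

Lemma sum_wt_le_zeta_seq (s : seq zs2) : uniq s -> {subset s <= reduced} ->
  \sum_(g <- s) wt g <= Z.
Proof.
move=> us sG; have := @sum_wt_le_zeta R [fset g | g in s]%fset.
have -> : \sum_(g <- [fset g | g in s]%fset) wt g = \sum_(g <- s) wt g.
  apply: perm_big; apply: uniq_perm => //.
  by move=> g; rewrite !inE.
by apply => g /imfsetP[x /= xs ->]; exact: sG.
Qed.

(** Cut the sum over g into a finite head and a tail. The head terms other than g = 1 have total
    weight at most 5/6 and obey the asymptotic bound from some [r] on; the tail has weight at most
    [tau], and only the uniform bound [B] is applied there. The asymptotic bound is assumed for all
    [l] because the head involves the windows of size l / g'. *)
Lemma contraction_step (B K : R) : 0 <= B -> 0 <= K ->
  (forall r l, 0 < r -> 0 < l -> `|(cnt (prims r l))%:R / (r * l) ^+ 2 - kap| <= B) ->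
  (forall l d, 0 < l -> 0 < d -> \forall r \near +oo,
    `|(cnt (prims r l))%:R / (r * l) ^+ 2 - kap| <= K + d) ->
  forall l d, 0 < l -> 0 < d -> \forall r \near +oo,
    `|(cnt (prims r l))%:R / (r * l) ^+ 2 - kap| <= 5 / 6 * K + d.
Proof.
move=> B0 K0 HB HK l d l0 d0.
have Z1 : 1 <= Z := @zeta_ge1 R.
have k0 : 0 <= kap by rewrite divr_ge0// (le_trans ler01).
pose e r l := (cnt (prims r l))%:R / (r * l) ^+ 2 - kap.
(* The tail affects the sum of errors by at most tau B and the weight of the limit by at most tau
   kap, together at most d / 4. *)
pose tau := d / (4 * (B + kap + 1)).
have tau0 : 0 < tau by rewrite divr_gt0// mulr_gt0//; lra.
have tauE : tau * (B + kap) <= d / 4.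
  rewrite /tau invfM mulrA mulrAC ler_pdivrMr; last lra.
  by rewrite ler_pM2l ?divr_gt0//; lra.
have [F0 F0G F0Z] := @zeta_approx R tau tau0.
pose F1 := [seq g <- F0 : seq zs2 | g != 1].
pose s := 1 :: F1.
have us : uniq s by rewrite /= mem_filter eqxx/= filter_uniq ?fset_uniq.
have sG : {subset s <= reduced}.
  by move=> g; rewrite inE => /orP[/eqP->//|]; rewrite mem_filter => /andP[_ /F0G].
have sZ : Z - tau <= \sum_(g <- s) wt g.
  rewrite (le_trans (ltW F0Z))//; apply: sum_uniq_sub => [|g gF|g]; last exact: wt_ge0.
    exact: fset_uniq.
  by rewrite inE mem_filter gF andbT; case: eqP.
have near1 : \forall r \near +oo, forall g, g \in F1 ->
    `|e (r / sig g) (l / sigb g)| <= K + d / 4.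
  apply: near_pinfty_seq => g gF.
  have [p1 p2] : 0 < sig g /\ 0 < sigb g.
    by apply: reduced_sig_gt0; apply: sG; rewrite inE gF orbT.
  by apply: (@near_pinfty_div _ _ (fun r => `|e r (l / sigb g)| <= K + d / 4) p1);
    apply: HK; rewrite divr_gt0.
have near2 : \forall r \near +oo, `|(cnt (nonzeros r l))%:R / (r * l) ^+ 2 - C| <= d / 4.
  have d4 : 0 < d / 4 by rewrite divr_gt0.
  move/cvgrPdist_le: (nonzerosC l0) => /(_ _ d4).
  by apply: filterS => r; rewrite distrC.
near=> r; have r0 : 0 < r by near: r; exact: nbhs_pinfty_gt.
have [t [ust tG E]] := nonzeros_decomp bD bW r0 l0 us sG.
have rl0 : (r * l) ^+ 2 != 0 by rewrite expf_neq0// mulf_neq0// gt_eqF.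
(* [wt g] is exactly the ratio of ((r / g) (l / g'))^2 to (r l)^2. *)
have {}E : (cnt (nonzeros r l))%:R / (r * l) ^+ 2 =
    \sum_(g <- s ++ t) wt g * (e (r / sig g) (l / sigb g) + kap).
  rewrite E natr_sum mulr_suml !big_seq; apply: eq_bigr => g gst.
  have Gg : reduced g by move: gst; rewrite mem_cat => /orP[/sG|/tG].
  have [p1 p2] := @reduced_sig_gt0 R g Gg.
  rewrite /e subrK /wt -sig_sigb.
  have p1' := lt0r_neq0 p1; have p2' := lt0r_neq0 p2.
  have r0' := lt0r_neq0 r0; have l0' := lt0r_neq0 l0.
  by field; rewrite p1' p2' r0' l0'.
have stZ : \sum_(g <- s ++ t) wt g <= Z.
  apply: sum_wt_le_zeta_seq => // g; rewrite mem_cat => /orP[/sG//|/tG//].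
move: stZ; rewrite big_cat => stZ.
move: E; under eq_bigr do rewrite mulrDr.
rewrite big_split -mulr_suml !big_cat big_cons /= -/s.
rewrite wt1 mul1r sig1 sigb1 !divr1.
set e1 := e r l; set S1 := \sum_(g <- F1) _; set S2 := \sum_(g <- t) _.
set ws := \sum_(g <- s) wt g in sZ stZ *; set wt' := \sum_(g <- t) wt g in stZ *.
move=> E.
have {}stZ : ws + wt' <= Z := stZ.
have S1b : `|S1| <= 5 / 6 * (K + d / 4).
  apply: le_trans (ler_norm_sum _ _ _) _.
  apply: (@le_trans _ _ (\sum_(g <- F1) wt g * (K + d / 4))).
    rewrite !big_seq; apply: ler_sum => g gF.
    rewrite normrM (ger0_norm (wt_ge0 _ _)); apply: ler_wpM2l; first exact: wt_ge0.
    by move: g gF; near: r.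
  rewrite -mulr_suml ler_wpM2r//; first lra.
  apply: sum_wt_bound; first by rewrite filter_uniq// fset_uniq.
  by move=> g; rewrite mem_filter => /andP[-> /F0G].
have S2b : `|S2| <= tau * B.
  apply: le_trans (ler_norm_sum _ _ _) _.
  apply: (@le_trans _ _ (\sum_(g <- t) wt g * B)).
    rewrite !big_seq; apply: ler_sum => g gt.
    have [p1 p2] := @reduced_sig_gt0 R g (tG _ gt).
    rewrite normrM (ger0_norm (wt_ge0 _ _)); apply: ler_wpM2l; first exact: wt_ge0.
    by apply: HB; rewrite divr_gt0.
  rewrite -mulr_suml ler_wpM2r// -/wt'; lra.
have n0 : `|(cnt (nonzeros r l))%:R / (r * l) ^+ 2 - C| <= d / 4 by near: r.
rewrite E in n0.
have CE : C = kap * Z by rewrite /kap divfK// gt_eqF// (lt_le_trans ltr01).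
have kb : 0 <= kap * (Z - (ws + wt')) <= kap * tau.
  have z1 : 0 <= Z - (ws + wt') by rewrite subr_ge0.
  have z2 : Z - (ws + wt') <= tau.
    have wt0 : 0 <= wt' by apply: sumr_ge0 => g _; exact: wt_ge0.
    lra.
  by rewrite mulr_ge0//= ler_wpM2l.
move: n0 S1b S2b; rewrite -[_ - kap]/e1 CE !ler_norml => /andP[n1 n2] /andP[a1 a2] /andP[b1 b2].
case/andP: kb => c1 c2.
by apply/andP; split; lra.
Unshelve. all: by end_near.
Qed.

Lemma prims_density l : 0 < l ->
  (cnt (prims r l))%:R / (r * l) ^+ 2 @[r --> +oo] --> kap.
Proof.
move=> l0.
have Z1 : 1 <= Z := @zeta_ge1 R.
have k0 : 0 <= kap by rewrite divr_ge0// (le_trans ler01).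
have [B B0 HB] := nonzeros_bound bD bW.
have HB' r m : 0 < r -> 0 < m -> `|(cnt (prims r m))%:R / (r * m) ^+ 2 - kap| <= B + kap.
  move=> r0 m0; have [fN cN] := HB r m r0 m0.
  have rm : 0 < (r * m) ^+ 2 by rewrite exprn_gt0// mulr_gt0.
  apply: le_trans (ler_normB _ _) _; rewrite (ger0_norm k0) lerD2r ger0_norm; last first.
    by rewrite divr_ge0// ltW.
  rewrite ler_pdivrMr//; apply: le_trans cN; rewrite ler_nat.
  exact: cnt_le (@prims_sub _ _ _ _ _).
have BK0 : 0 <= B + kap by rewrite addr_ge0// ltW.
have main n : forall m d, 0 < m -> 0 < d -> \forall r \near +oo,
    `|(cnt (prims r m))%:R / (r * m) ^+ 2 - kap| <= (5 / 6) ^+ n * (B + kap) + d.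
  elim: n => [|n IH] m d m0 d0.
    near=> r; have r0 : 0 < r by near: r; exact: nbhs_pinfty_gt.
    by rewrite expr0 mul1r (le_trans (HB' _ _ r0 m0))// lerDl ltW.
  have K0 : 0 <= (5 / 6) ^+ n * (B + kap) by rewrite mulr_ge0// exprn_ge0//; lra.
  by rewrite exprS -mulrA; apply: (contraction_step BK0 K0 HB' IH).
apply/cvgrPdist_le => d d0.
have d2 : 0 < d / 2 by rewrite divr_gt0.
have [n hn] : exists n, (5 / 6) ^+ n * (B + kap) <= d / 2.
  have h1 : `|5 / 6 : R| < 1 by rewrite ger0_norm; lra.
  have e0 : 0 < d / 2 / (B + kap + 1) by rewrite !divr_gt0//; lra.
  have /cvgrPdist_le/(_ _ e0)[n _ /(_ n (leqnn n))] := cvg_expr h1.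
  rewrite sub0r normrN ger0_norm; last by rewrite exprn_ge0//; lra.
  move=> hn; exists n; apply: le_trans (_ : d / 2 / (B + kap + 1) * (B + kap) <= _).
    exact: ler_wpM2r.
  by rewrite mulrAC ler_pdivrMr; [rewrite ler_pM2l//; lra|lra].
apply: filterS (main n l _ l0 d2) => r; rewrite distrC => /le_trans; apply.
by lra.
Unshelve. all: by end_near.
Qed.
End Contraction.

(** * Lattice points in a product of intervals *)

Section Lattice.
Variable R : realType.
Local Notation s2 := (Num.sqrt (2 : R)).
Local Notation sig := (sig R).
Local Notation sigb := (sigb R).

Lemma int_cnt (a b : R) : a <= b -> finite_set [set n : int | a <= n%:~R < b] /\
  b - a - 1 <= (cnt [set n : int | a <= n%:~R < b])%:R <= b - a + 1.
Proof.
move=> ab; have [ca caE] : exists ca : int, ca = Num.ceil a by exists (Num.ceil a).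
have [cb cbE] : exists cb : int, cb = Num.ceil b by exists (Num.ceil b).
have cab : (ca <= cb)%R by rewrite caE cbE; exact: le_ceil.
pose N := `|(cb - ca)%R|%N.
have -> : [set n : int | a <= n%:~R < b] = (fun k : nat => ca + k%:Z) @` `I_N.
  apply/seteqP; split=> [n /= /andP[an nb]|_ [k /= kN <-]].
    have {}an : (ca <= n)%R by rewrite caE ceil_le_int.
    have {}nb : (n < cb)%R by rewrite cbE ceil_gt_int.
    by exists `|(n - ca)%R|%N; [rewrite /= /N|]; lia.
  have h1 : (ca <= ca + k%:Z)%R by lia.
  have h2 : (ca + k%:Z < cb)%R by move: kN; rewrite /N; lia.
  by rewrite -ceil_le_int -ceil_gt_int -caE -cbE h1 h2.
have fN : finite_set `I_N by exact: finite_II.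
split; first exact: finite_image.
rewrite cnt_image// => [|x y _ _ /addrI[]//].
rewrite cnt_II /N natr_absz ger0_norm ?subr_ge0// rmorphB /= caE cbE.
have /andP[a1 a2] := ceil_itv a; have /andP[b1 b2] := ceil_itv b.
by move: a1 b1; rewrite !rmorphB /= => a1 b1; apply/andP; split; lra.
Qed.

(** Divisibility by sqrt 2 means an even rational part, so M consists of the pairs whose two
    rational parts have the same parity. Once that parity [p] is fixed, the coordinates are
    independent. *)
Definition lat (p : nat) (A L c d : R) := [set x : zs2 |
  [/\ (2 %| rpart x - p%:Z)%Z, A <= sig x < A + L & c <= sigb x < c + d]].

Lemma sig_sub_sigb x : sig x = sigb x + 2 * s2 * (ipart x)%:~R.
Proof. by rewrite /sig /sigb; ring. Qed.

(** An element and its conjugate differ by 2 sqrt 2 times the irrational part, so the latter ranges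
    over an interval of length L / (2 sqrt 2), up to end effects of the window. *)
Lemma lat_window2 p A L c : 0 <= L -> finite_set (lat p A L c 2) /\
  L / (2 * s2) - 2 <= (cnt (lat p A L c 2))%:R <= L / (2 * s2) + 2.
Proof.
move=> L0; have /andP[sl su] := sqrt2_bounds R.
have s20 : 0 < 2 * s2 by rewrite mulr_gt0// sqrt2_gt0.
have i2 : 2 / (2 * s2) <= 1 by rewrite ler_pdivrMr//; lra.
have ubd : (A - c - 2) / (2 * s2) <= (A + L - c) / (2 * s2).
  by rewrite ler_pM2r ?invr_gt0//; lra.
have [fU /andP[_ cU]] := int_cnt ubd.
have [||fl cl] := @inj_finite_cnt _ _ ipart (lat p A L c 2) _ fU.
- move=> x y; rewrite !inE => -[px _ /andP[x1 x2]] [py _ /andP[y1 y2]] E.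
  apply: zs2_eqP => //; move: x1 x2 y1 y2; rewrite /sigb E => x1 x2 y1 y2.
  have h1 : (rpart x)%:~R - (rpart y)%:~R < 2 :> R by lra.
  have h2 : (rpart y)%:~R - (rpart x)%:~R < 2 :> R by lra.
  rewrite -rmorphB (_ : 2 = 2%:~R)// ltr_int in h1.
  rewrite -rmorphB (_ : 2 = 2%:~R)// ltr_int in h2.
  move: px py h1 h2 => /dvdzP[k +] /dvdzP[l +].
  move: (rpart x) (rpart y) => a b ka lb h1 h2.
  clear - ka lb h1 h2; by lia.
- move=> x [_ /andP[x1 x2] /andP[y1 y2]] /=.
  rewrite ler_pdivrMr// ltr_pdivlMr//.
  by move: x1 x2; rewrite sig_sub_sigb => x1 x2; apply/andP; split; lra.
split=> //; apply/andP; split; last first.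
  move: cl; rewrite -(ler_nat R) => /le_trans; apply.
  by apply: le_trans cU _; rewrite -mulrBl (_ : A + L - c - (A - c - 2) = L + 2);
    [rewrite mulrDl; lra|ring].
have [L2|L2] := ltP L 2.
  have : L / (2 * s2) <= 2 / (2 * s2) by rewrite ler_pM2r ?invr_gt0// ltW.
  by move=> h; apply: (@le_trans _ _ 0) => //; lra.
have lbd : (A - c) / (2 * s2) <= (A + L - c - 2) / (2 * s2).
  by rewrite ler_pM2r ?invr_gt0//; lra.
have [fV /andP[cV _]] := int_cnt lbd.
(* The integer congruent to p modulo 2 for which m - n sqrt 2 lies in [c, c + 2). *)
pose m (n : int) : int := p%:Z + 2 * Num.ceil ((c + n%:~R * s2 - p%:R) / 2).
have mP n : c <= (m n)%:~R - n%:~R * s2 < c + 2.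
  rewrite /m rmorphD rmorphM /=.
  have := ceil_itv ((c + n%:~R * s2 - p%:R) / 2); set k := Num.ceil _.
  rewrite rmorphB /= => /andP[k1 k2].
  have -> : (p%:Z)%:~R = p%:R :> R by [].
  by apply/andP; split; lra.
have [||_ cl'] := @inj_finite_cnt _ _ (fun n : int => ZS2 (m n) n)
  [set n : int | (A - c) / (2 * s2) <= n%:~R < (A + L - c - 2) / (2 * s2)] _ fl.
- by move=> x y _ _ [].
- move=> n /=; rewrite ler_pdivrMr// ltr_pdivlMr// => /andP[n1 n2].
  have := mP n => /andP[m1 m2].
  split.
  - by rewrite /= /m addrC addKr; apply/dvdzP; eexists; rewrite mulrC.
  - by rewrite sig_sub_sigb /sigb /=; apply/andP; split; lra.
  - by rewrite /sigb /=; apply/andP.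
move: cl'; rewrite -(ler_nat R); apply: le_trans.
by apply: le_trans cV; rewrite -mulrBl (_ : A + L - c - 2 - (A - c) = L - 2);
  [rewrite mulrBl; lra|ring].
Qed.

(** Cut the window into pieces of length 2: the error 2 on each piece accumulates to [d], and an
    incomplete last piece accounts for [L]. *)
Lemma lat_window p A L c d : 0 <= L -> 0 <= d -> finite_set (lat p A L c d) /\
  L * d / (4 * s2) - L - d - 2 <= (cnt (lat p A L c d))%:R <= L * d / (4 * s2) + L + d + 2.
Proof.
move=> L0 d0; have /andP[sl su] := sqrt2_bounds R.
have s20 : 0 < 2 * s2 by rewrite mulr_gt0// sqrt2_gt0.
pose k := `|Num.floor (d / 2)|%N.
have /andP[k1 k2] := floor_itv (d / 2).
have kE : (Num.floor (d / 2))%:~R = k%:R :> R.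
  by rewrite /k natr_absz ger0_norm// floor_ge0 divr_ge0.
rewrite rmorphD /= kE in k1 k2.
pose F (i : nat) := lat p A L (c + 2 * i%:R) 2.
have FF i : finite_set (F i) by have [] := @lat_window2 p A L (c + 2 * i%:R) L0.
have dis (n : nat) (i j : nat) x : i \in iota 0 n -> j \in iota 0 n -> F i x -> F j x -> i = j.
  move=> _ _ [_ _ /andP[i1 i2]] [_ _ /andP[j1 j2]].
  have h1 : i%:R - j%:R < 1 :> R by lra.
  have h2 : j%:R - i%:R < 1 :> R by lra.
  rewrite ltrBlDr (_ : 1 + j%:R = j.+1%:R) ?ltr_nat ?natr1// in h1;
    last by rewrite -natr1 addrC.
  rewrite ltrBlDr (_ : 1 + i%:R = i.+1%:R) ?ltr_nat ?natr1// in h2;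
    last by rewrite -natr1 addrC.
  by apply/eqP; rewrite eqn_leq; apply/andP; split; [exact: h1|exact: h2].
have cov n := @cnt_bigcup _ _ (iota 0 n) F (iota_uniq _ _) (fun i _ => FF i) (@dis n).
have sumE n (b : R) : \sum_(i <- iota 0 n) b = n%:R * b.
  by rewrite big_const_seq count_predT size_iota iter_addr_0 mulr_natl.
have up : lat p A L c d `<=` \bigcup_(i in [set` iota 0 k.+1]) F i.
  move=> x [px xA /andP[x1 x2]].
  pose i := `|Num.floor ((sigb x - c) / 2)|%N.
  have /andP[i1 i2] := floor_itv ((sigb x - c) / 2).
  have iE : (Num.floor ((sigb x - c) / 2))%:~R = i%:R :> R.
    by rewrite /i natr_absz ger0_norm// floor_ge0 divr_ge0// subr_ge0.
  rewrite rmorphD /= iE in i1 i2.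
  have ik : i \in iota 0 k.+1.
    by rewrite mem_iota add0n -(ltr_nat R) -natr1; apply/andP; split=> //; lra.
  by exists i => //; split=> //; apply/andP; split; lra.
have dn : \bigcup_(i in [set` iota 0 k]) F i `<=` lat p A L c d.
  move=> x [i /=]; rewrite mem_iota /= add0n => ik [px xA /andP[x1 x2]].
  have i0 : 0 <= i%:R :> R by [].
  have ik' : i%:R + 1 <= k%:R :> R by rewrite natr1 ler_nat.
  by split=> //; apply/andP; split; lra.
have [fu cu] := cov k.+1; have [_ cd] := cov k.
have fl := sub_finite_set up fu.
have U : (cnt (lat p A L c d))%:R <= (k.+1)%:R * (L / (2 * s2) + 2).
  apply: (@le_trans _ _ (cnt (\bigcup_(i in [set` iota 0 k.+1]) F i))%:R).
    by rewrite ler_nat; exact: cnt_le.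
  rewrite cu natr_sum -sumE; apply: ler_sum => i _.
  by have [_ /andP[]] := @lat_window2 p A L (c + 2 * i%:R) L0.
have Lo : k%:R * (L / (2 * s2) - 2) <= (cnt (lat p A L c d))%:R.
  apply: (@le_trans _ _ (cnt (\bigcup_(i in [set` iota 0 k]) F i))%:R); last first.
    by rewrite ler_nat; exact: cnt_le.
  rewrite cd natr_sum -sumE; apply: ler_sum => i _.
  by have [_ /andP[]] := @lat_window2 p A L (c + 2 * i%:R) L0.
split=> //.
have -> : L * d / (4 * s2) = (L / (2 * s2)) * (d / 2).
  by field; rewrite gt_eqF// sqrt2_gt0.
set M := L / (2 * s2) in U Lo *.
have ML : 0 <= M <= L.
  rewrite /M divr_ge0 ?(ltW s20)//= ler_pdivrMr// ler_peMr//; lra.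
rewrite -natr1 in U.
have k0 : 0 <= k%:R :> R by [].
move: ML => /andP[M0 ML]; apply/andP; split; nra.
Qed.

Definition etaR : R := 3 + 2 * s2.

Lemma etaR_gt1 : 1 < etaR.
Proof. by rewrite /etaR; have := sqrt2_gt0 R; lra. Qed.

Lemma etaRV : etaR^-1 = 3 - 2 * s2.
Proof.
apply: (@mulfI _ etaR); first by rewrite gt_eqF// (lt_trans ltr01)// etaR_gt1.
rewrite mulfV; last by rewrite gt_eqF// (lt_trans ltr01)// etaR_gt1.
have := sqrt2_sqr R; rewrite /etaR; set t := s2 => t2.
by rewrite (_ : _ * _ = 9 - 4 * t ^+ 2); [rewrite t2|]; ring.
Qed.

Lemma sig_ieta x : sig (sqfunitV * x) = sig x / etaR.
Proof. by rewrite sigM etaRV mulrC /sig /=; congr (_ * _); rewrite rmorphN; ring. Qed.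
Lemma sigb_ieta x : sigb (sqfunitV * x) = sigb x * etaR.
Proof. by rewrite sigbM mulrC /sigb /etaR /=; congr (_ * _); rewrite rmorphN; ring. Qed.

(** Multiplication by 3 - 2 sqrt 2 keeps the parity class, as the new rational part is 3 a - 4 b,
    while shrinking values and stretching conjugates by the same factor. *)
Lemma lat_scale p A L c d : 0 <= L -> 0 <= d ->
  cnt (lat p A L c d) = cnt (lat p (A / etaR) (L / etaR) (c * etaR) (d * etaR)).
Proof.
move=> L0 d0; have e0 : 0 < etaR := lt_trans ltr01 etaR_gt1.
have -> : lat p (A / etaR) (L / etaR) (c * etaR) (d * etaR) = ( *%R sqfunitV) @` lat p A L c d.
  have eqv x : lat p A L c d x <->
      lat p (A / etaR) (L / etaR) (c * etaR) (d * etaR) (sqfunitV * x).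
    rewrite /lat /= sig_ieta sigb_ieta -!mulrDl !ler_pM2r ?ltr_pM2r ?invr_gt0//.
    suff -> : (2 %| rpart (sqfunitV * x)%R - p%:Z)%Z = (2 %| rpart x - p%:Z)%Z by [].
    rewrite rpartM /= (_ : _ - _ = (rpart x - p%:Z) + (rpart x - 2 * ipart x) * 2);
      last by ring.
    by rewrite rpredDr ?dvdz_mull.
  apply/seteqP; split=> [x Lx|_ [x /eqv Lx <-]//].
  have E : sqfunitV * (sqfunit * x) = x by rewrite mulrA -[X in _ = X]mul1r.
  by exists (sqfunit * x) => //; apply/eqv; rewrite E.
rewrite cnt_image//; first by have [] := @lat_window p A L c d L0 d0.
by move=> x y _ _ /mulfI; apply.
Qed.

(** The error in [lat_window] has order [L], like the main term. Scaling by a unit preserves the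
    product L d, so the free exponent [j] moves the error from [L] to [d]. *)
Lemma lat_cnt p A L c d j : 0 <= L -> 0 <= d ->
  `|(cnt (lat p A L c d))%:R - L * d / (4 * s2)| <= L / etaR ^+ j + d * etaR ^+ j + 2.
Proof.
move=> L0 d0; have e0 : 0 < etaR := lt_trans ltr01 etaR_gt1.
have ej i : 0 < etaR ^+ i by rewrite exprn_gt0.
have -> : cnt (lat p A L c d) =
    cnt (lat p (A / etaR ^+ j) (L / etaR ^+ j) (c * etaR ^+ j) (d * etaR ^+ j)).
  elim: j => [|j ->]; first by rewrite !expr0 !divr1 !mulr1.
  rewrite lat_scale; first by rewrite exprSr !mulrA !invfM !mulrA.
    by rewrite divr_ge0// ltW.
  by rewrite mulr_ge0// ltW.
have Lj : 0 <= L / etaR ^+ j by rewrite divr_ge0// ltW.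
have dj : 0 <= d * etaR ^+ j by rewrite mulr_ge0// ltW.
have [_ /andP[h1 h2]] := @lat_window p (A / etaR ^+ j) _ (c * etaR ^+ j) _ Lj dj.
have E : L / etaR ^+ j * (d * etaR ^+ j) = L * d.
  by rewrite mulrACA [_^-1 * _]mulrC mulfV ?mulr1// gt_eqF.
rewrite E in h1 h2.
by rewrite ler_norml; apply/andP; split; lra.
Qed.

Lemma lat_cvg p a L c d : 0 <= L -> 0 <= d ->
  (cnt (lat p (r * a) (r * L) c d))%:R / r @[r --> +oo] --> L * d / (4 * s2).
Proof.
move=> L0 d0; have e1 := etaR_gt1; have e0 : 0 < etaR := lt_trans ltr01 e1.
apply/cvgrPdist_le => e ep.
(* [j] is fixed first, to make the part of the error proportional to r small; a large r then absorbs
   the constant d eta^j + 2. *)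
have [j hj] : exists j, L / etaR ^+ j <= e / 2.
  have h1 : `|etaR^-1| < 1 by rewrite ger0_norm ?invr_ge0 ?ltW// invf_lt1.
  have d2 : 0 < e / 2 / (L + 1) by rewrite !divr_gt0//; lra.
  have /cvgrPdist_le/(_ _ d2)[n _ /(_ n (leqnn n))] := cvg_expr h1.
  rewrite sub0r normrN ger0_norm; last by rewrite exprn_ge0// invr_ge0 ltW.
  move=> hn; exists n; rewrite -exprVn; apply: le_trans (_ : L * (e / 2 / (L + 1)) <= _).
    exact: ler_wpM2l.
  by rewrite mulrC mulrAC ler_pdivrMr; [rewrite ler_pM2l ?divr_gt0//; lra|lra].
pose M := (d * etaR ^+ j + 2) / (e / 2).
near=> r.
have r0 : 0 < r by near: r; exact: nbhs_pinfty_gt.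
have rM : M <= r by near: r; apply: nbhs_pinfty_ge; rewrite num_real.
have rL : 0 <= r * L by rewrite mulr_ge0// ltW.
have := @lat_cnt p (r * a) (r * L) c d j rL d0.
have -> : L * d / (4 * s2) - (cnt (lat p (r * a) (r * L) c d))%:R / r =
   - ((cnt (lat p (r * a) (r * L) c d))%:R - r * L * d / (4 * s2)) / r.
  by field; rewrite ?(gt_eqF r0) ?(gt_eqF (sqrt2_gt0 R)).
rewrite normrM normrN normfV (gtr0_norm r0) ler_pdivrMr// => /le_trans; apply.
have h1 : r * L / etaR ^+ j <= r * (e / 2) by rewrite -mulrA ler_pM2l.
have h2 : d * etaR ^+ j + 2 <= r * (e / 2).
  by move: rM; rewrite /M ler_pdivrMr// divr_gt0.
lra.
Unshelve. all: by end_near.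
Qed.

End Lattice.

(** * Points of M in products of boxes *)

Lemma even_or_odd (z : int) : (2 %| z - 0%:Z)%Z \/ (2 %| z - 1%:Z)%Z.
Proof.
by case: (int_parity z) => -[y ->]; [left|right]; apply/dvdzP; exists y; ring.
Qed.

Lemma not_even_odd (z : int) : (2 %| z - 0%:Z)%Z -> (2 %| z - 1%:Z)%Z -> False.
Proof. by move=> /dvdzP[i iE] /dvdzP[j jE]; lia. Qed.

Section Boxes.
Variable R : realType.
Local Notation s2 := (Num.sqrt (2 : R)).
Local Notation sig := (sig R).
Local Notation sigb := (sigb R).
Local Notation pos := (@pos R).
Local Notation star := (@star R).

Definition box (a b h : R) : set (R * R) :=
  [set x | a <= x.1 < a + h /\ b <= x.2 < b + h].

Definition points (D E : set (R * R)) := [set v | D (pos v) /\ E (star v)].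

Lemma dilate_box r a b h x : 0 < r ->
  dilate r (box a b h) x <-> box (r * a) (r * b) (r * h) x.
Proof.
move=> r0; rewrite dilateP ?gt_eqF//; case: x => x y.
rewrite /box /= -![r^-1 *: _]/(r^-1 * _) ![r^-1 * _]mulrC.
by rewrite !ler_pdivlMr// !ltr_pdivrMr// ![(_ + h) * r]mulrDl ![_ * r]mulrC.
Qed.

(** The points split by the common parity of their two coordinates, and each parity class is a
    product of two counts in one coordinate. *)
Lemma points_box_cnt r a b h c d k : 0 < r -> 0 <= h -> 0 <= k ->
  finite_set (points (dilate r (box a b h)) (box c d k)) /\
  cnt (points (dilate r (box a b h)) (box c d k)) =
  (cnt (lat 0 (r * a) (r * h) c k) * cnt (lat 0 (r * b) (r * h) d k) +
   cnt (lat 1 (r * a) (r * h) c k) * cnt (lat 1 (r * b) (r * h) d k))%N.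
Proof.
move=> r0 h0 k0; have rh0 : 0 <= r * h by rewrite mulr_ge0// ltW.
pose phi := fun v : zs2 * zs2 => (v.1, v.1 + rt2 * v.2).
have fl p A c' : finite_set (lat p A (r * h) c' k).
  by have [] := @lat_window R p A _ c' _ rh0 k0.
pose X p := lat p (r * a) (r * h) c k `*` lat p (r * b) (r * h) d k.
have fX p : finite_set (X p) by exact: finite_setX.
have E : phi @` points (dilate r (box a b h)) (box c d k) = X 0%N `|` X 1%N.
  apply/seteqP; split.
    move=> _ [v [/(dilate_box _ _ _ _ r0)[p1 p2] [q1 q2]] <-].
    have par : (2 %| rpart v.1 - 0%:Z)%Z \/ (2 %| rpart v.1 - 1%:Z)%Z.
      exact: even_or_odd.
    have e2 q : (2 %| rpart (v.1 + rt2 * v.2)%R - q)%Z = (2 %| rpart v.1 - q)%Z.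
      rewrite !partE /= (_ : _ - q = (rpart v.1 - q) + ipart v.2 * 2); last by ring.
      by rewrite rpredDr ?dvdz_mull.
    by case: par => par; [left|right]; split; split; rewrite ?e2.
  have sub p : X p `<=` phi @` points (dilate r (box a b h)) (box c d k).
    move=> [x y] [[/= px x1 x2] [/= py y1 y2]].
    have [z zE] : exists z, y = x + rt2 * z.
      move: px py => /dvdzP[i iE] /dvdzP[j jE].
      exists (ZS2 (ipart y - ipart x) (j - i)).
      apply: zs2_eqP; rewrite !partE /=; last by ring.
      have -> : rpart y = j * 2 + p by rewrite -jE; ring.
      have -> : rpart x = i * 2 + p by rewrite -iE; ring.
      by ring.
    exists (x, z); last by rewrite /phi /= -zE.
    by split; [apply/dilate_box => //; split|split]; rewrite /= -?zE.
  by move=> u [/sub|/sub].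
have fin : finite_set (points (dilate r (box a b h)) (box c d k)).
  have : finite_set (X 0%N `|` X 1%N) by rewrite finite_setU.
  rewrite -E => /(@sub_finite_set _ _ _ (@subset_refl _ _)).
  by rewrite (eq_finite_set (inj_card_eq _)) => // v w _ _; exact: basis_inj.
split=> //; rewrite -(@cnt_image _ _ phi)//; last by move=> v w _ _; exact: basis_inj.
rewrite E cntU//.
  by rewrite !cntX.
apply/seteqP; split=> // -[x y] [[[/= p0 _ _] _] [[/= p1 _ _] _]].
exact: not_even_odd p0 p1.
Qed.

(** Each coordinate contributes h k / (4 sqrt 2), whose square is h^2 k^2 / 32; the two parity
    classes double it. *)
Lemma points_box_cvg a b h c d k : 0 <= h -> 0 <= k ->
  (cnt (points (dilate r (box a b h)) (box c d k)))%:R / r ^+ 2 @[r --> +oo]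
    --> (h ^+ 2 * k ^+ 2 / 16 : R).
Proof.
move=> h0 k0; set u := h * k / (4 * s2).
have uE : h ^+ 2 * k ^+ 2 / 16 = u * u + u * u.
  rewrite /u; have := sqrt2_sqr R; have := sqrt2_gt0 R; set t := s2 => t0 t2.
  have -> : 16 = 8 * t ^+ 2 by rewrite t2; ring.
  by field; rewrite gt_eqF.
rewrite uE.
pose f p a c r := (cnt (lat p (r * a) (r * h) c k))%:R / r.
apply: cvg_trans (_ : (f 0%N a c r * f 0%N b d r + f 1%N a c r * f 1%N b d r)
   @[r --> +oo] --> _); last first.
  by apply: cvgD; apply: cvgM; exact: lat_cvg.
apply: near_eq_cvg; near=> r.
have r0 : 0 < r by near: r; exact: nbhs_pinfty_gt.
have [_ ->] := @points_box_cnt r a b h c d k r0 h0 k0.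
rewrite natrD !natrM /f; field; exact: lt0r_neq0.
Unshelve. all: by end_near.
Qed.

End Boxes.

(** * Jordan measurable sets *)

Section Grid.
Variable R : realType.
Implicit Types D : set (R * R).
Local Notation mu := (@lebesgue_measure R \x @lebesgue_measure R)%E.

(** Dyadic meshes, so that each grid refines the previous one and the union of the mixed cells
    decreases. *)
Definition mesh n : R := (2 ^+ n)^-1.
Definition gidx n (x : R * R) : int * int :=
  (Num.floor (x.1 * 2 ^+ n), Num.floor (x.2 * 2 ^+ n)).
Definition gbox n (i : int * int) : set (R * R) :=
  box (i.1%:~R * mesh n) (i.2%:~R * mesh n) (mesh n).

Lemma mesh_gt0 n : 0 < mesh n. Proof. by rewrite invr_gt0 exprn_gt0. Qed.

Lemma floor_mesh n (z : R) (i : int) :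
  (i%:~R * mesh n <= z < i%:~R * mesh n + mesh n) = (Num.floor (z * 2 ^+ n) == i).
Proof.
have p : 0 < 2 ^+ n :> R by rewrite exprn_gt0.
rewrite -{3}[mesh n]mul1r -mulrDl ler_pdivrMr// ltr_pdivlMr//.
rewrite -[1]/(1%:~R) -rmorphD /= eq_sym.
by apply/idP/eqP => [/floor_def->//|->]; exact: floor_itv.
Qed.

Lemma gboxP n i x : gbox n i x <-> gidx n x = i.
Proof.
rewrite /gbox /box /= !floor_mesh /gidx; case: i => i j /=.
by split=> [[/eqP-> /eqP->]//|[-> ->]].
Qed.

Lemma gbox_gidx n x : gbox n (gidx n x) x. Proof. exact/gboxP. Qed.

Lemma boxX (a b h : R) : box a b h = `[a, a + h[%classic `*` `[b, b + h[%classic.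
Proof. by apply/seteqP; split=> x; rewrite /box /= !in_itv. Qed.

Lemma measurable_box (a b h : R) : measurable (box a b h).
Proof. by rewrite boxX; apply: measurableX; exact: measurable_itv. Qed.

Lemma mu_box (a b h : R) : 0 < h -> mu (box a b h) = (h ^+ 2)%:E.
Proof.
move=> h0; have E (c : R) : lebesgue_measure `[c, c + h[%classic = h%:E.
  by rewrite lebesgue_measure_itv /= lte_fin ltrDl h0 -EFinB addrAC subrr add0r.
rewrite boxX expr2 EFinM -{1}(E a) -(E b).
by apply: product_measure1E; exact: measurable_itv.
Qed.

Lemma measurable_boxes (I : choiceType) (s : seq I) (c : I -> R * R) h :
  measurable (\bigcup_(i in [set` s]) box (c i).1 (c i).2 h).
Proof.
apply: fin_bigcup_measurable => [|i _]; first exact: finite_seq.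
exact: measurable_box.
Qed.

Lemma mu_boxes (I : choiceType) (s : seq I) (c : I -> R * R) h :
  0 < h -> uniq s ->
  (forall i j x, box (c i).1 (c i).2 h x -> box (c j).1 (c j).2 h x -> i = j) ->
  mu (\bigcup_(i in [set` s]) box (c i).1 (c i).2 h) = ((size s)%:R * h ^+ 2)%:E.
Proof.
move=> h0 us cdis; rewrite measure_fin_bigcup; first last.
- by move=> i _; exact: measurable_box.
- by move=> i j _ _ [x [xi xj]]; exact: cdis xi xj.
- exact: finite_seq.
rewrite fsbig_finite/=; last exact: finite_seq.
rewrite (eq_bigr (fun=> (h ^+ 2)%:E)) => [|i _]; last exact: mu_box.
have sz : size (fset_set [set` s]) = size s.
  apply: perm_size; apply: uniq_perm => // i.
  rewrite in_fset_set; last exact: finite_seq.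
  by apply/idP/idP => [/set_mem|si]; [|exact/mem_set].
by rewrite sumEFin big_const_seq count_predT iter_addr_0 sz mulr_natl.
Qed.

Lemma area_measurable D : measurable D -> area D = mu D.
Proof. by move=> mD; rewrite /area measurable_mu_extE. Qed.

Definition gcorner n (i : int * int) : R * R := (i.1%:~R * mesh n, i.2%:~R * mesh n).

Definition gunion n (s : seq (int * int)) := \bigcup_(i in [set` s]) gbox n i.

Lemma measurable_gunion n s : measurable (gunion n s).
Proof. exact: (@measurable_boxes _ s (gcorner n) (mesh n)). Qed.

Lemma mu_gunion n s : uniq s -> mu (gunion n s) = ((size s)%:R * mesh n ^+ 2)%:E.
Proof.
move=> us; apply: (mu_boxes (c := gcorner n) (mesh_gt0 n) us) => i j x.
by move=> /gboxP <- /gboxP <-.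
Qed.

Lemma area_gunion n s : uniq s -> area (gunion n s) = ((size s)%:R * mesh n ^+ 2)%:E.
Proof.
by move=> us; rewrite area_measurable ?mu_gunion//; exact: measurable_gunion.
Qed.

Lemma le_area D E : D `<=` E -> (area D <= area E)%E.
Proof. exact: le_mu_ext. Qed.

Lemma gidx_refine n x y : gidx n.+1 x = gidx n.+1 y -> gidx n x = gidx n y.
Proof.
have aux (a b : R) : Num.floor (a * 2 ^+ n.+1) = Num.floor (b * 2 ^+ n.+1) ->
    Num.floor (a * 2 ^+ n) <= Num.floor (b * 2 ^+ n).
  move=> E; rewrite floor_ge_int.
  have h : 2 * Num.floor (a * 2 ^+ n) <= Num.floor (a * 2 ^+ n.+1).
    rewrite floor_ge_int rmorphM /= exprS mulrCA ler_pM2l//.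
    by have /andP[] := floor_itv (a * 2 ^+ n).
  move: h; rewrite E floor_ge_int rmorphM /= exprS mulrCA ler_pM2l//.
by rewrite /gidx => -[E1 E2]; congr pair; apply/eqP; rewrite eq_le !aux.
Qed.

Lemma gidx_close n x y : gidx n x = gidx n y -> `|x - y| <= mesh n.
Proof.
have aux (a b : R) : Num.floor (a * 2 ^+ n) = Num.floor (b * 2 ^+ n) -> `|a - b| <= mesh n.
  move=> E; have := floor_mesh n a (Num.floor (b * 2 ^+ n)).
  have := floor_mesh n b (Num.floor (b * 2 ^+ n)).
  rewrite E eqxx => /andP[b1 b2] /andP[a1 a2].
  by rewrite ler_norml; apply/andP; split; lra.
by move=> [E1 E2]; rewrite prod_normE ge_max !aux.
Qed.

Lemma mesh_cvg0 (e : R) : 0 < e -> exists n, mesh n < e.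
Proof.
move=> e0; have h1 : `|2^-1 : R| < 1 by rewrite ger0_norm; lra.
have /cvgrPdist_lt/(_ _ e0)[n _ /(_ n (leqnn n))] := cvg_expr h1.
rewrite sub0r normrN ger0_norm; last by rewrite exprn_ge0.
by rewrite exprVn; exists n.
Qed.

Definition gmixed D n : set (int * int) :=
  [set i | (exists2 x, gbox n i x & D x) /\ (exists2 x, gbox n i x & ~ D x)].

(** If the cells of [x] at all scales meet both [D] and its complement, then [x] is a limit of
    points of either. *)
Lemma mixed_boundary D :
  \bigcap_n [set x | gmixed D n (gidx n x)] `<=` boundary D.
Proof.
move=> x Tx.
have near_x (e : R) : 0 < e -> (exists2 y, D y & ball x e y) /\ (exists2 y, ~ D y & ball x e y).
  move=> /mesh_cvg0[n ne]; have [[y yb Dy] [z zb Dz]] := Tx n I.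
  split; [exists y|exists z] => //; rewrite -ball_normE /=; apply: le_lt_trans ne;
    by apply: gidx_close; apply/esym/gboxP.
split.
  move=> B /nbhs_ballP[e /= e0 eB]; have [[y Dy yB] _] := near_x e e0.
  by exists y; split=> //; exact: eB.
move=> /nbhs_ballP[e /= e0 eB]; have [_ [y Dy yB]] := near_x e e0.
by apply: Dy; exact: eB.
Qed.

Lemma finite_gidx D n : bounded_set D -> finite_set [set i | exists2 x, gbox n i x & D x].
Proof.
move=> /bounded_set_box[k k0 kD].
have p : 0 < 2 ^+ n :> R by rewrite exprn_gt0.
have kk : - (k * 2 ^+ n) - 1 <= k * 2 ^+ n + 1.
  have : 0 < k * 2 ^+ n by rewrite mulr_gt0.
  by lra.
have [fI _] := int_cnt kk.
apply: sub_finite_set (finite_setX fI fI) => i [x /gboxP <- /kD[]].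
have aux (z : R) : `|z| <= k ->
    - (k * 2 ^+ n) - 1 <= (Num.floor (z * 2 ^+ n))%:~R < k * 2 ^+ n + 1.
  rewrite ler_norml => /andP[z1 z2].
  have := floor_itv (z * 2 ^+ n); rewrite rmorphD /= => /andP[f1 f2].
  have h1 : - (k * 2 ^+ n) <= z * 2 ^+ n by rewrite -mulNr ler_pM2r.
  have h2 : z * 2 ^+ n <= k * 2 ^+ n by rewrite ler_pM2r.
  by apply/andP; split; lra.
by move=> /aux h1 /aux h2.
Qed.

(** [outer] consists of the cells meeting [D], [inner] of those contained in [D]; they differ by the
    mixed cells. The unions of the mixed cells decrease to a subset of the boundary, so their
    measures tend to 0 by continuity from above. *)
Lemma jordan_grid D (e : R) : jordan_measurable D -> 0 < e ->
  exists n inner outer, [/\ uniq inner /\ uniq outer, gunion n inner `<=` D,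
    D `<=` gunion n outer & (size outer)%:R * mesh n ^+ 2 <= (size inner)%:R * mesh n ^+ 2 + e].
Proof.
move=> [bD aD] e0.
pose out n : seq _ := fset_set [set i | exists2 x, gbox n i x & D x].
have outP n i : i \in out n <-> exists2 x, gbox n i x & D x.
  by rewrite in_fset_set ?inE//; exact: finite_gidx.
pose mix n := [seq i <- out n | `[< exists2 x, gbox n i x & ~ D x >]].
have mixP n i : i \in mix n <-> gmixed D n i.
  rewrite mem_filter; split=> [/andP[/asboolP h1 /outP h2]//|[h1 h2]].
  by apply/andP; split; [exact/asboolP|exact/outP].
have umix n : uniq (mix n) by rewrite filter_uniq// fset_uniq.
have TE n : gunion n (mix n) = [set x | gmixed D n (gidx n x)].
  apply/seteqP; split=> [x [i /= /mixP im /gboxP ->]//|x /= xm].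
  by exists (gidx n x); [exact/mixP|exact: gbox_gidx].
pose F n := gunion n (mix n).
have Fcap : mu (\bigcap_n F n) = 0%E.
  have mF : measurable (\bigcap_n F n).
    by apply: bigcap_measurable => // n _; exact: measurable_gunion.
  (* The boundary is null for the outer measure [area], which is monotone and agrees with [mu] on
     this measurable intersection. *)
  apply/eqP; rewrite eq_le measure_ge0 andbT -aD.
  rewrite -(area_measurable mF).
  apply: le_area => x Fx; apply: mixed_boundary => n _; rewrite -TE; exact: Fx.
have : mu \o F @ \oo --> mu (\bigcap_n F n).
  apply: nonincreasing_cvg_mu.
  - have mu0 : (mu (F 0%N) < +oo)%E by rewrite /F mu_gunion// ltry.
    exact: mu0.
  - by move=> n; exact: measurable_gunion.
  - by apply: bigcap_measurable => // n _; exact: measurable_gunion.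
  - apply/nonincreasing_seqP => n; apply/subsetPset; rewrite /F !TE => x /=.
    move=> [[y yb Dy] [z zb Dz]]; split.
      by exists y => //; apply/gboxP/gidx_refine/gboxP.
    by exists z => //; apply/gboxP/gidx_refine/gboxP.
rewrite Fcap => /fine_cvgP[_ /cvgrPdist_le/(_ _ e0)[n _ /(_ n (leqnn n))]].
rewrite /= mu_gunion//= sub0r normrN => hn.
exists n, [seq i <- out n | ~~ `[< exists2 x, gbox n i x & ~ D x >]], (out n); split.
- by rewrite filter_uniq ?fset_uniq.
- move=> x [i /=]; rewrite mem_filter => /andP[/asboolPn h _] xi.
  by apply: contrapT => nDx; apply: h; exists x.
- move=> x Dx; exists (gidx n x); last exact: gbox_gidx.
  by apply/outP; exists x => //; exact: gbox_gidx.
rewrite -(count_predC (fun i => `[< exists2 x, gbox n i x & ~ D x >]) (out n)).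
rewrite natrD mulrDl addrC size_filter lerD2l.
by apply: le_trans hn; rewrite size_filter ler_norm.
Qed.

End Grid.

(** * Areas and point counts for Jordan measurable sets *)

Section Count.
Variable R : realType.
Implicit Types D E W : set (R * R).
Local Notation mu := (@lebesgue_measure R \x @lebesgue_measure R)%E.

Lemma dilate_gbox r n i : 0 < r -> dilate r (@gbox R n i) =
  box (r * (i.1%:~R * mesh R n)) (r * (i.2%:~R * mesh R n)) (r * mesh R n).
Proof. by move=> r0; apply/seteqP; split=> x /dilate_box; apply. Qed.

Lemma dilate_gunion r n s : dilate r (@gunion R n s) =
  \bigcup_(i in [set` s]) dilate r (@gbox R n i).
Proof.
apply/seteqP; split=> [_ [x [i si xi] <-]|_ [i si [x xi <-]]].
  by exists i => //; exists x.
by exists x => //; exists i.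
Qed.

Lemma dilate_sub r D E : D `<=` E -> dilate r D `<=` dilate r E.
Proof. by move=> DE _ [x Dx <-]; exists x => //; exact: DE. Qed.

Lemma dilate_gbox_inj r n i j x : 0 < r ->
  dilate r (@gbox R n i) x -> dilate r (@gbox R n j) x -> i = j.
Proof.
move=> r0 /dilateP-/(_ (lt0r_neq0 r0))/gboxP <- /dilateP-/(_ (lt0r_neq0 r0))/gboxP <-.
by [].
Qed.

Lemma area_dilate_gunion r n s : 0 < r -> uniq s ->
  area (dilate r (@gunion R n s)) = ((size s)%:R * (r * mesh R n) ^+ 2)%:E.
Proof.
move=> r0 us; rewrite dilate_gunion.
rewrite (eq_bigcupr (fun i _ => dilate_gbox n i r0)).
pose c (i : int * int) := (r * (gcorner R n i).1, r * (gcorner R n i).2).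
rewrite area_measurable; last exact: (measurable_boxes s c).
apply: (mu_boxes (c := c)) => [|//|i j x]; first by rewrite mulr_gt0// mesh_gt0.
by rewrite -!dilate_gbox//; exact: dilate_gbox_inj.
Qed.

Lemma jordan_area D : jordan_measurable D -> exists2 a : R, 0 <= a & area D = a%:E.
Proof.
move=> jD; have [n [I [Ou [[uI uO] ID DsO sz]]]] := jordan_grid jD (@ltr01 R).
have a0 : (0 <= area D)%E by exact: mu_ext_ge0.
have : (area D <= ((size Ou)%:R * mesh R n ^+ 2)%:E)%E.
  by rewrite -area_gunion//; exact: le_area.
case: (area D) a0 => [a||]//; rewrite lee_fin => a0 _.
by exists a.
Qed.

(** Scaling is clear for unions of grid boxes, and the outer measure of the dilate is squeezed
    between the dilated inner and outer unions; [D] need not be Borel. *)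
Lemma area_dilate D r a : 0 < r -> jordan_measurable D -> area D = a%:E ->
  area (dilate r D) = (r ^+ 2 * a)%:E.
Proof.
move=> r0 jD aD.
have key e : 0 < e -> exists b, [/\ area (dilate r D) = b%:E,
    b <= r ^+ 2 * a + r ^+ 2 * e & r ^+ 2 * a <= b + r ^+ 2 * e].
  move=> e0; have [n [I [Ou [[uI uO] ID DsO sz]]]] := jordan_grid jD e0.
  have rr : 0 < r ^+ 2 by rewrite exprn_gt0.
  have h1 : ((size I)%:R * mesh R n ^+ 2 <= a)
    by rewrite -lee_fin -aD -area_gunion//; exact: le_area.
  have h2 : (a <= (size Ou)%:R * mesh R n ^+ 2)
    by rewrite -lee_fin -aD -area_gunion//; exact: le_area.
  have h3 : (((size I)%:R * (r * mesh R n) ^+ 2)%:E <= area (dilate r D))%E.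
    by rewrite -area_dilate_gunion//; apply/le_area/dilate_sub.
  have h4 : (area (dilate r D) <= ((size Ou)%:R * (r * mesh R n) ^+ 2)%:E)%E.
    by rewrite -area_dilate_gunion//; apply/le_area/dilate_sub.
  case: (area (dilate r D)) h3 h4 => [b||]//; rewrite !lee_fin exprMn => h3 h4.
  exists b; split=> //.
    apply: le_trans h4 _; rewrite mulrCA -mulrDr ler_pM2l//; lra.
  have : r ^+ 2 * a <= r ^+ 2 * ((size I)%:R * mesh R n ^+ 2 + e) by rewrite ler_pM2l//; lra.
  by move: h3; rewrite mulrCA mulrDr; lra.
have [b [bE _ _]] := key 1 ltr01; rewrite bE; congr (_%:E).
apply/eqP; rewrite eq_le; apply/andP; split; apply/ler_addgt0Pl => e e0.
  have rr : 0 < e / r ^+ 2 by rewrite divr_gt0// exprn_gt0.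
  have [b' []] := key _ rr; rewrite bE => -[<-].
  by rewrite [r ^+ 2 * (_ / _)]mulrC divfK ?expf_neq0 ?gt_eqF// => h1 h2; lra.
have rr : 0 < e / r ^+ 2 by rewrite divr_gt0// exprn_gt0.
have [b' []] := key _ rr; rewrite bE => -[<-].
by rewrite [r ^+ 2 * (_ / _)]mulrC divfK ?expf_neq0 ?gt_eqF// => h1 h2; lra.
Qed.

Definition boxpoints r l n m (p : (int * int) * (int * int)) :=
  points (dilate r (@gbox R n p.1)) (dilate l (@gbox R m p.2)).

Lemma boxpoints_finite r l n m p : 0 < r -> 0 < l -> finite_set (boxpoints r l n m p).
Proof.
move=> r0 l0; rewrite /boxpoints (dilate_gbox m _ l0).
have m0 : 0 <= mesh R n by rewrite ltW// mesh_gt0.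
have lm0 : 0 <= l * mesh R m by rewrite mulr_ge0// ltW// mesh_gt0.
by have [] := points_box_cnt (p.1.1%:~R * mesh R n) (p.1.2%:~R * mesh R n)
  (l * (p.2.1%:~R * mesh R m)) (l * (p.2.2%:~R * mesh R m)) r0 m0 lm0.
Qed.

Lemma boxpoints_cvg l n m s : 0 < l ->
  (\sum_(p <- s) cnt (boxpoints r l n m p))%:R / r ^+ 2 @[r --> +oo] -->
    (size s)%:R * (mesh R n ^+ 2 * (l * mesh R m) ^+ 2 / 16).
Proof.
move=> l0; have m0 : 0 <= mesh R n by rewrite ltW// mesh_gt0.
have lm0 : 0 <= l * mesh R m by rewrite mulr_ge0// ltW// mesh_gt0.
elim: s => [|p s IH].
  under eq_fun do rewrite big_nil mul0r.
  by rewrite mul0r; exact: cvg_cst.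
under eq_fun do rewrite big_cons natrD mulrDl.
rewrite /= -[(size s).+1]add1n natrD mulrDl mul1r; apply: cvgD => //.
rewrite /boxpoints; under eq_fun do rewrite (dilate_gbox m _ l0).
exact: points_box_cvg.
Qed.

Lemma points_bigcup r l n m (s t : seq (int * int)) : 0 < r -> 0 < l -> uniq s -> uniq t ->
  finite_set (points (dilate r (@gunion R n s)) (dilate l (@gunion R m t))) /\
  cnt (points (dilate r (@gunion R n s)) (dilate l (@gunion R m t))) =
  (\sum_(p <- [seq (i, j) | i <- s, j <- t]) cnt (boxpoints r l n m p))%N.
Proof.
move=> r0 l0 us ut.
have -> : points (dilate r (@gunion R n s)) (dilate l (@gunion R m t)) =
    \bigcup_(p in [set` [seq (i, j) | i <- s, j <- t]]) boxpoints r l n m p.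
  rewrite !dilate_gunion; apply/seteqP; split.
    move=> v [[i si vi] [j tj vj]]; exists (i, j) => //=.
    by apply/allpairsP; exists (i, j).
  move=> v [_ /= /allpairsP[[i j] [/= si tj ->]] [vi vj]].
  by split; [exists i|exists j].
apply: cnt_bigcup.
- by apply: allpairs_uniq => // -[a b] [c d] _ _ [-> ->].
- by move=> p _; exact: boxpoints_finite.
- move=> [i j] [i' j'] v _ _ [/= vi vj] [/= vi' vj'].
  by rewrite (dilate_gbox_inj r0 vi vi') (dilate_gbox_inj l0 vj vj').
Qed.

Lemma squeeze_approx (f : R -> R) X :
  (forall e, 0 < e -> exists l u l0 u0, [/\ \forall r \near +oo, l r <= f r <= u r,
    l r @[r --> +oo] --> l0, u r @[r --> +oo] --> u0, X - e <= l0 & u0 <= X + e]) ->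
  f r @[r --> +oo] --> X.
Proof.
move=> H; apply/cvgrPdist_le => e e0; have e2 : 0 < e / 2 by rewrite divr_gt0.
have [l [u [l0 [u0 [h hl hu hl0 hu0]]]]] := H _ e2.
move/cvgrPdist_le : hl => /(_ _ e2) hl; move/cvgrPdist_le : hu => /(_ _ e2) hu.
near=> r.
have /andP[h1 h2] : l r <= f r <= u r by near: r.
have : `|l0 - l r| <= e / 2 by near: r.
have : `|u0 - u r| <= e / 2 by near: r.
rewrite !ler_norml => /andP[a1 a2] /andP[b1 b2].
apply/andP; split; lra.
Unshelve. all: by end_near.
Qed.

Lemma points_cvg D W l a b : jordan_measurable D -> jordan_measurable W -> 0 < l ->
  area D = a%:E -> area W = b%:E ->
  (cnt (points (dilate r D) (dilate l W)))%:R / r ^+ 2 @[r --> +oo] --> a * b * l ^+ 2 / 16.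
Proof.
move=> jD jW l0 aD bW.
have a0 : 0 <= a by rewrite -lee_fin -aD; exact: mu_ext_ge0.
have b0 : 0 <= b by rewrite -lee_fin -bW; exact: mu_ext_ge0.
apply: squeeze_approx => e' e'0.
have ll : 0 < l ^+ 2 by rewrite exprn_gt0.
pose e := e' / l ^+ 2; have e0 : 0 < e by rewrite divr_gt0.
have eE : e' = e * l ^+ 2 by rewrite /e divfK// gt_eqF.
(* This gives d <= 1, and then (a + d) (b + d) <= a b + d (a + b + 1) <= a b + e. *)
pose d := e / (a + b + 1 + e).
have q0 : 0 < a + b + 1 + e by lra.
have d0 : 0 < d by rewrite divr_gt0.
have d1 : d <= 1 by rewrite ler_pdivrMr//; lra.
have de : d * (a + b + 1) <= e.
  by rewrite /d mulrAC ler_pdivrMr// ler_pM2l//; lra.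
have [n [I [Ou [[uI uO] ID DsO sz]]]] := jordan_grid jD d0.
have [m [I' [Ou' [[uI' uO'] IW WsO sz']]]] := jordan_grid jW d0.
have h1 : (size I)%:R * mesh R n ^+ 2 <= a
  by rewrite -lee_fin -aD -area_gunion//; exact: le_area.
have h2 : a <= (size Ou)%:R * mesh R n ^+ 2
  by rewrite -lee_fin -aD -area_gunion//; exact: le_area.
have h3 : (size I')%:R * mesh R m ^+ 2 <= b
  by rewrite -lee_fin -bW -area_gunion//; exact: le_area.
have h4 : b <= (size Ou')%:R * mesh R m ^+ 2
  by rewrite -lee_fin -bW -area_gunion//; exact: le_area.
have x0 : 0 <= (size I)%:R * mesh R n ^+ 2 by rewrite mulr_ge0// sqr_ge0.
have y0 : 0 <= (size I')%:R * mesh R m ^+ 2 by rewrite mulr_ge0// sqr_ge0.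
exists (fun r =>
  (\sum_(p <- [seq (i, j) | i <- I, j <- I']) cnt (boxpoints r l n m p))%:R / r ^+ 2).
exists (fun r =>
  (\sum_(p <- [seq (i, j) | i <- Ou, j <- Ou']) cnt (boxpoints r l n m p))%:R / r ^+ 2).
exists ((size [seq (i, j) | i <- I, j <- I'])%:R *
  (mesh R n ^+ 2 * (l * mesh R m) ^+ 2 / 16)).
exists ((size [seq (i, j) | i <- Ou, j <- Ou'])%:R *
  (mesh R n ^+ 2 * (l * mesh R m) ^+ 2 / 16)).
split; [|exact: boxpoints_cvg|exact: boxpoints_cvg| |].
- near=> r; have r0 : 0 < r by near: r; exact: nbhs_pinfty_gt.
  have [_ <-] := points_bigcup n m r0 l0 uI uI'.
  have [fO <-] := points_bigcup n m r0 l0 uO uO'.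
  have sub : points (dilate r D) (dilate l W) `<=`
      points (dilate r (gunion n Ou)) (dilate l (gunion m Ou')).
    by move=> v [/(dilate_sub DsO) ? /(dilate_sub WsO) ?].
  rewrite !ler_pM2r ?invr_gt0 ?exprn_gt0// !ler_nat; apply/andP; split.
    apply: cnt_le; first exact: sub_finite_set sub fO.
    by move=> v [/(dilate_sub ID) ? /(dilate_sub IW) ?].
  exact: cnt_le.
- rewrite size_allpairs natrM exprMn.
  set x := (size I)%:R * _ in h1 x0 sz; set y := (size I')%:R * _ in h3 y0 sz'.
  rewrite (_ : _ * (_ / 16) = x * y * l ^+ 2 / 16); last by rewrite /x /y; ring.
  suff : a * b - e <= x * y by rewrite eE; nra.
  have : (a - x) * b <= d * b by rewrite ler_wpM2r//; lra.
  have : x * (b - y) <= a * d by apply: ler_pM => //; lra.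
  by nra.
rewrite size_allpairs natrM exprMn.
set x := (size Ou)%:R * _ in h2 sz; set y := (size Ou')%:R * _ in h4 sz'.
rewrite (_ : _ * (_ / 16) = x * y * l ^+ 2 / 16); last by rewrite /x /y; ring.
suff : x * y <= a * b + e by rewrite eE; nra.
have xa : x <= a + d by lra.
have yb : y <= b + d by lra.
have : x * y <= (a + d) * (b + d) by apply: ler_pM => //; lra.
have : d * d <= d by rewrite -[leRHS]mulr1 ler_pM2l.
by nra.
Unshelve. all: by end_near.
Qed.

(** Only the zero vector separates this count from that of [points_cvg], and 1 / r^2 tends to 0. *)
Lemma nonzeros_cvg D W l a b : jordan_measurable D -> jordan_measurable W -> 0 < l ->
  area D = a%:E -> area W = b%:E ->
  (cnt (nonzeros D W r l))%:R / (r * l) ^+ 2 @[r --> +oo] --> a * b / 16.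
Proof.
move=> jD jW l0 aD bW; have ll : 0 < l ^+ 2 by rewrite exprn_gt0.
apply: squeeze_approx => e e0.
exists (fun r => ((cnt (points (dilate r D) (dilate l W)))%:R / r ^+ 2 - (r ^+ 2)^-1) / l ^+ 2).
exists (fun r => ((cnt (points (dilate r D) (dilate l W)))%:R / r ^+ 2) / l ^+ 2).
exists ((a * b * l ^+ 2 / 16 - 0) / l ^+ 2), ((a * b * l ^+ 2 / 16) / l ^+ 2).
have E : (a * b * l ^+ 2 / 16) / l ^+ 2 = a * b / 16 by field; exact: lt0r_neq0.
split; last 2 first.
- by rewrite subr0 E; lra.
- by rewrite E; lra.
- near=> r; have r0 : 0 < r by near: r; exact: nbhs_pinfty_gt.
  have rr : 0 < r ^+ 2 by rewrite exprn_gt0.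
  have [B B0 HB] := nonzeros_bound jD.1 jW.1; have [fN _] := HB r l r0 l0.
  have sub1 : nonzeros D W r l `<=` points (dilate r D) (dilate l W) by move=> v [].
  have sub2 : points (dilate r D) (dilate l W) `<=` nonzeros D W r l `|` [set 0].
    by move=> v [h1 h2]; have [->|v0] := eqVneq v 0; [right|left].
  have fU : finite_set (nonzeros D W r l `|` [set 0]) by rewrite finite_setU.
  have fP := sub_finite_set sub2 fU.
  have c1 : (cnt (nonzeros D W r l) <= cnt (points (dilate r D) (dilate l W)))%N.
    exact: cnt_le.
  have c2 : (cnt (points (dilate r D) (dilate l W)) <= cnt (nonzeros D W r l) + 1)%N.
    apply: leq_trans (cnt_le fU sub2) _; rewrite cntU//.
      by rewrite leq_add2l /cnt fset_set1 cardfs1.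
    by apply/seteqP; split=> // v [[/eqP v0 _ _]].
  have -> : (cnt (nonzeros D W r l))%:R / (r * l) ^+ 2 =
      (cnt (nonzeros D W r l))%:R / r ^+ 2 / l ^+ 2 :> R.
    by rewrite exprMn invfM mulrA.
  rewrite !ler_pM2r ?invr_gt0//; apply/andP; split; last by rewrite ler_nat.
  rewrite lerBlDr -[X in _ <= _ + X]mul1r -mulrDl ler_pM2r ?invr_gt0//.
  by rewrite natr1 ler_nat -addn1.
- apply: cvgMl; apply: cvgB; first exact: points_cvg.
  apply/cvgrPdist_le => e' e'0; near=> r.
  have r0 : 0 < r by near: r; exact: nbhs_pinfty_gt.
  have re : e'^-1 <= r by near: r; apply: nbhs_pinfty_ge; rewrite num_real.
  have r1 : 1 <= r by near: r; apply: nbhs_pinfty_ge; rewrite num_real.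
  rewrite sub0r normrN ger0_norm ?invr_ge0 ?sqr_ge0//.
  rewrite -[e']invrK lef_pV2 ?posrE ?invr_gt0 ?exprn_gt0//.
  by apply: le_trans re _; rewrite expr2 ler_peMl// ltW.
- apply: cvgMl; exact: points_cvg.
Unshelve. all: by end_near.
Qed.

End Count.

(** * The octagonal window *)

Section Window.
Variable R : realType.
Local Notation s2 := (Num.sqrt (2 : R)).
Local Notation mu := (@lebesgue_measure R \x @lebesgue_measure R)%E.
Local Notation W := (@window R).

Definition octangle (k : nat) : R := 2 * k%:R * pi / 8.
Definition dir k (x : R * R) : R := x.1 * cos (octangle k) + x.2 * sin (octangle k).
Definition inradius : R := s2 * (1 / (2 * tan (pi / 8))).

Lemma inradius_gt0 : 0 < inradius.
Proof.
have p0 := pi_gt0 R.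
have s0 : 0 < sin (pi / 8 : R) by apply: sin_gt0_pi; rewrite divr_gt0//=; lra.
have c0 : 0 < cos (pi / 8 : R) by apply: cos_gt0_pihalf; apply/andP; split; lra.
by rewrite mulr_gt0 ?sqrt2_gt0// divr_gt0// mulr_gt0// divr_gt0.
Qed.

Lemma dirZ k t x : dir k (t *: x) = t * dir k x.
Proof. by rewrite /dir /= -![t *: _]/(t * _) mulrDr !mulrA. Qed.

Lemma dirB k x y : dir k (x - y) = dir k x - dir k y.
Proof. by rewrite /dir /=; ring. Qed.

Lemma norm_dir k x : `|dir k x| <= `|x.1| + `|x.2|.
Proof.
apply: le_trans (ler_normD _ _) _; rewrite !normrM; apply: lerD.
  by rewrite -[leRHS]mulr1 ler_wpM2l// cos_max.
by rewrite -[leRHS]mulr1 ler_wpM2l// sin_max.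
Qed.

Lemma windowE x : W x <-> forall k, (k < 8)%N -> dir k x <= inradius.
Proof.
rewrite /window dilateP ?gt_eqF ?sqrt2_gt0//.
have aux k : (dir k (s2^-1 *: x) <= 1 / (2 * tan (pi / 8))) = (dir k x <= inradius).
  by rewrite dirZ ler_pdivrMl ?sqrt2_gt0.
by split=> H k k8; [rewrite -aux|rewrite -[_ <= _]/(dir k (s2^-1 *: x) <= _) aux]; exact: H.
Qed.

(** The normals [k] and [k + 4] are opposite, which makes the window centrally symmetric. *)
Lemma dir_opp k : (k < 8)%N -> exists2 k', (k' < 8)%N & forall x, dir k' x = - dir k x.
Proof.
move=> k8; have [k4|k4] := ltnP k 4.
  exists (k + 4)%N; first by lia.
  have E : octangle (k + 4) = octangle k + pi by rewrite /octangle natrD; field.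
  by move=> x; rewrite /dir E cosDpi sinDpi; ring.
exists (k - 4)%N; first by lia.
have E : octangle k = octangle (k - 4) + pi by rewrite /octangle natrB//; field.
by move=> x; rewrite /dir E cosDpi sinDpi; ring.
Qed.

Lemma windowP x : W x <-> forall k, (k < 8)%N -> `|dir k x| <= inradius.
Proof.
rewrite windowE; split=> H k k8; last exact: le_trans (ler_norm _) (H _ k8).
have [k' k'8 E] := dir_opp k8.
by rewrite ler_norml H// andbT lerNl -E H.
Qed.

Lemma window_scale t x : `|t| <= 1 -> W x -> W (t *: x).
Proof.
move=> t1 /windowP H; apply/windowP => k k8; rewrite dirZ normrM.
by apply: le_trans (H _ k8); rewrite -[leRHS]mul1r ler_wpM2r.
Qed.

Lemma dir0 x : dir 0 x = x.1.
Proof. by rewrite /dir /octangle mulr0 mul0r mul0r cos0 sin0 mulr1 mulr0 addr0. Qed.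

Lemma dir2 x : dir 2 x = x.2.
Proof.
rewrite /dir (_ : octangle 2 = pi / 2); last by rewrite /octangle; field.
by rewrite cos_pihalf sin_pihalf mulr1 mulr0 add0r.
Qed.

Lemma window_bounded : bounded_set W.
Proof.
exists inradius; split; first exact: num_real.
move=> M wM x /windowP H; apply: le_trans (ltW wM).
by rewrite prod_normE ge_max -{1}dir0 -dir2 !H.
Qed.

Lemma common_gap n (f : nat -> R) : (forall k, (k < n)%N -> 0 < f k) ->
  exists2 e, 0 < e & forall k, (k < n)%N -> e <= f k.
Proof.
elim: n => [|n IH] H; first by exists 1.
have [|e e0 he] := IH; first by move=> k kn; apply: H; exact: ltnW.
have fn := H n (ltnSn n).
exists (Num.min e (f n)); first by rewrite lt_min e0.
move=> k; rewrite ltnS leq_eqVlt => /orP[/eqP->|kn]; rewrite ge_min ?lexx ?orbT//.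
by rewrite he.
Qed.

(** By closedness a boundary point satisfies all eight inequalities; if none were an equality, they
    would hold with a common margin and the point would be interior. *)
Lemma window_boundary : boundary W `<=` \bigcup_k [set x | dir k x = inradius].
Proof.
move=> x [cx nx]; apply: contrapT => H; apply: nx.
have nk k : dir k x != inradius by apply/eqP => E; apply: H; exists k.
have near_x (e : R) : 0 < e -> exists2 y, W y & `|x.1 - y.1| + `|x.2 - y.2| <= e.
  move=> e0; have e2 : 0 < e / 2 by rewrite divr_gt0.
  have [y [Wy]] := cx _ (nbhsx_ballx x _ e2).
  rewrite -ball_normE /= prod_normE gt_max /= => /andP[h1 h2].
  exists y => //; lra.
have lt k : (k < 8)%N -> 0 < inradius - dir k x.
  move=> k8; rewrite subr_gt0 lt_neqAle nk /=; apply/ler_addgt0Pl => e e0.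
  have [y /windowE Wy xy] := near_x _ e0.
  have := le_trans (norm_dir k (x - y)) xy; rewrite dirB => /ler_normlP[_ h].
  have := Wy _ k8; lra.
have [e e0 he] := common_gap lt.
have e2 : 0 < e / 2 by rewrite divr_gt0.
apply/nbhs_ballP; exists (e / 2) => //= y.
rewrite -ball_normE /= prod_normE gt_max /= => /andP[h1 h2].
apply/windowE => k k8; have := he _ k8.
have := norm_dir k (x - y); rewrite dirB => /ler_normlP[h _] h3.
by move: h; rewrite /= => h; lra.
Qed.

Lemma measurable_line k c : measurable [set x : R * R | dir k x = c].
Proof.
have mf : measurable_fun [set: R * R] (dir k).
  apply: measurable_funD; apply: measurable_funM => //.
have := mf measurableT _ (measurable_set1 c); rewrite setTI.
by congr measurable.
Qed.

(** A vertical line is a point times the real line; any other line meets each vertical line in one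
    point, and Fubini applies. *)
Lemma mu_line k c : mu [set x : R * R | dir k x = c] = 0%E.
Proof.
have [s0|s0] := eqVneq (sin (octangle k)) 0.
  have c0 : cos (octangle k) != 0.
    apply/eqP => c0; have := cos2Dsin2 (octangle k); rewrite s0 c0 !expr0n/= addr0.
    by move/eqP; rewrite eq_sym oner_eq0.
  have -> : [set x : R * R | dir k x = c] = [set c / cos (octangle k)] `*` [set: R].
    apply/seteqP; split=> [[x y]|[x y]] /=; rewrite /dir /= s0 mulr0 addr0.
      by move=> <-; rewrite mulfK.
    by move=> [-> _]; rewrite divfK.
  transitivity (lebesgue_measure [set (c / cos (octangle k))%R] * lebesgue_measure [set: R])%E.
    by apply: product_measure1E => //; exact: measurable_set1.
  by rewrite lebesgue_measure_set1 mul0e.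
rewrite /product_measure1; apply: integral0_eq => x _ /=.
have -> : xsection [set x : R * R | dir k x = c] x =
    [set (c - x * cos (octangle k)) / sin (octangle k)].
  apply/seteqP; split=> y; rewrite /xsection /= ?inE /= /dir /=.
    by move=> <-; field.
  by move=> ->; field.
exact: lebesgue_measure_set1.
Qed.

Lemma window_jordan : jordan_measurable W.
Proof.
split; first exact: window_bounded.
have : mu.-negligible (\bigcup_k [set x | dir k x = inradius]).
  apply: negligible_bigcup => k; exists [set x | dir k x = inradius]; split=> //.
    exact: measurable_line.
  exact: mu_line.
move=> [B [mB B0 sB]]; apply/eqP; rewrite eq_le; apply/andP; split; last exact: mu_ext_ge0.
rewrite -B0 -(area_measurable mB).
by apply: le_area; exact: subset_trans window_boundary sB.
Qed.

Lemma window_area : exists2 b : R, 0 < b & area W = b%:E.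
Proof.
have [b b0 bE] := jordan_area window_jordan; exists b => //.
have w0 := inradius_gt0.
have sub : box 0 0 (inradius / 2) `<=` W.
  move=> x [/andP[x1 x2] /andP[y1 y2]]; apply/windowP => k k8.
  by apply: le_trans (norm_dir _ _) _; rewrite !ger0_norm//; lra.
have := le_area sub; rewrite bE area_measurable; last exact: measurable_box.
rewrite mu_box ?divr_gt0// lee_fin; apply: lt_le_trans.
by rewrite exprn_gt0// divr_gt0.
Qed.

End Window.

(** * Visible points *)

Section AmmannBeenker.
Variable R : realType.
Local Notation s2 := (Num.sqrt (2 : R)).
Local Notation sig := (sig R).
Local Notation sigb := (sigb R).
Local Notation pos := (@pos R).
Local Notation star := (@star R).
Local Notation W := (@window R).

Lemma ammann_beenker_scaledE :
  @ammann_beenker_scaled R = pos @` [set v | W (star v)].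
Proof.
rewrite /ammann_beenker_scaled ring_of_integersE; apply/seteqP; split.
  move=> [x y] /= [[a _ aE] [c _ cE] [d _ dE] Wx].
  have s0 := sqrt2_gt0 R.
  (* [d] stands for (x.1 - x.2) / sqrt 2, whereas the basis writes x.2 = x.1 + sqrt 2 v.2, hence the
     sign. *)
  have cE2 : c = a + rt2 * (- d).
    apply: (@sig_inj R); rewrite sigD sigM sigN sig_rt2 dE cE aE.
    by field; exact: lt0r_neq0.
  exists (a, - d); last by rewrite /pos /= -cE2 aE cE.
  by rewrite /star /= -cE2 -!conjK_sig aE cE.
move=> _ [v Wv <-]; split.
- by exists v.1.
- by exists (v.1 + rt2 * v.2).
- exists (- v.2) => //=; rewrite sigD sigM sigN sig_rt2.
  by field; rewrite gt_eqF// sqrt2_gt0.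
- by rewrite /= !conjK_sig.
Qed.

Lemma visible_dilate (c : R) (P : set (R * R)) : c != 0 ->
  visible (dilate c P) = dilate c (visible P).
Proof.
move=> c0; apply/seteqP; split=> [_ [[x Px <-] H]|_ [x [Px H] <-]].
  exists x => //; split=> // t t01 Ptx; apply: (H t t01).
  by exists (t *: x) => //; rewrite !scalerA mulrC.
split; first by exists x.
move=> t t01 [y Py E]; apply: (H t t01).
have -> : t *: x = y; last by [].
by apply: (scalerI c0); rewrite E !scalerA mulrC.
Qed.

(** This makes nonprimitive vectors invisible: s p lies on the segment before g p, and its conjugate
    is that of g p scaled by s' / g', so it stays in the window. The choice s = 1 works unless g' <
    1, which happens only for g = 2 + sqrt 2; there s = 1 + sqrt 2 works. *)
Lemma reduced_reduce g : reduced g -> g != 1 ->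
  exists s, 0 < sig s < sig g /\ `|sigb s| <= sigb g.
Proof.
move=> Gg g1; case/and3P: (Gg) => h1 h2 h3; have /andP[sl su] := sqrt2_bounds R.
have [g21|g21] := eqVneq g (ZS2 2 1).
  exists eps; rewrite g21 /sig /sigb /eps /=; split.
    by apply/andP; split; lra.
  by rewrite ler_norml; apply/andP; split; lra.
exists 1; rewrite sig1 sigb1 normr1 ltr01 /=.
have a2 : 2 <= rpart g.
  rewrite leNgt; apply/negP => a1; case/eqP: g1; apply: zs2_eqP; rewrite partE; lia.
have [a4|a4] := leP 4 (rpart g).
  have c1 : 4 <= (rpart g)%:~R :> R by rewrite -(ler_int R) in a4.
  have c2 : - (rpart g)%:~R < 2 * (ipart g)%:~R :> R
    by rewrite -(ltr_int R) rmorphM rmorphN in h2.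
  have c3 : 2 * (ipart g)%:~R <= (rpart g)%:~R :> R by rewrite -(ler_int R) rmorphM in h3.
  by rewrite /sig /sigb; split; nra.
have cases : [\/ (rpart g = 2 /\ ipart g = 0), (rpart g = 3 /\ ipart g = 0),
    (rpart g = 3 /\ ipart g = 1) | (rpart g = 3 /\ ipart g = -1)].
  have [r2|r3] : rpart g = 2 \/ rpart g = 3 by lia.
    have [i0|i1] : ipart g = 0 \/ ipart g = 1 by lia.
      by constructor 1.
    by case/eqP: g21; apply: zs2_eqP.
  have [i0|[i1|i1]] : ipart g = 0 \/ ipart g = 1 \/ ipart g = -1 by lia.
  - by constructor 2.
  - by constructor 3.
  - by constructor 4.
by rewrite /sig /sigb; case: cases => -[-> ->] /=; split; lra.
Qed.

(** If b is the irrational part, the conjugate is s - 2 b sqrt 2. No integer lies in (0, 1), so b is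
    not 0; b = 1 forces s = sqrt 2 - 1, which attains the bound; every other b gives a larger
    absolute value. *)
Lemma conj_of_small s : 0 < sig s < 1 -> 1 + s2 <= `|sigb s|.
Proof.
move=> /andP[]; have /andP[sl su] := sqrt2_bounds R; rewrite /sig /sigb.
set a := rpart s; set b := ipart s => h1 h2.
have [b0|b0|b0] := ltgtP b 0; last first.
- exfalso; move: h1 h2; rewrite b0 mul0r addr0 ltr0z.
  by rewrite -[1]/(1%:~R) ltr_int; lia.
- have [b1|b1] := eqVneq b 1.
    move: h1 h2; rewrite b1 mul1r => h1 h2.
    have aE : a = -1.
      have : -2 < a.
        by rewrite -(ltr_int R) rmorphN /=; lra.
      have : a < 0.
        by rewrite -(ltr_int R) /=; lra.
      lia.
    by rewrite aE rmorphN /= ler0_norm; lra.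
  have b2 : 2 <= b by lia.
  have b2R : 2 <= b%:~R :> R by rewrite -(ler_int R) in b2.
  by rewrite ler0_norm; nra.
have b1 : b <= -1 by lia.
have b1R : b%:~R <= -1 :> R by rewrite -(ler_int R) rmorphN in b1.
by rewrite ger0_norm; nra.
Qed.

Lemma pos0 : pos 0 = 0.
Proof.
have -> : 0 = smul 0 0 by rewrite /smul !mul0r.
by rewrite pos_smul sig0 scale0r.
Qed.

Definition visible_index := [set v | [/\ prim v, W (star v) & ~ W ((1 + s2) *: star v)]].

(** A point is hidden by [reduced_reduce] if it is not primitive, and by its multiple sqrt 2 - 1 if
    the shrunken window contains its conjugate. Conversely, a factor hiding a primitive vector must
    lie in O, and [conj_of_small] bounds its conjugate from below. *)
Lemma visible_scaledE : visible (@ammann_beenker_scaled R) = pos @` visible_index.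
Proof.
have /andP[sl su] := sqrt2_bounds R.
rewrite ammann_beenker_scaledE; apply/seteqP; split.
  move=> _ [[v Wv <-] H].
  have v0 : v != 0.
    apply/eqP => v0; apply: (H (1 / 2)); first by apply/andP; split; lra.
    by exists v => //; rewrite v0 pos0 scaler0.
  exists v => //; split=> //.
    move=> g w vE; have g0 : g != 0 by apply: contra_neq v0 => g0; rewrite vE g0 /smul !mul0r.
    have [u uu Gu] := reduced_exists g0.
    have [ug1|ug1] := eqVneq (u * g) 1.
      by apply/unitrP; exists u; rewrite ug1 mulrC.
    have [s [/andP[s0 sg] sb]] := reduced_reduce Gu ug1.
    have [p1 p2] := @reduced_sig_gt0 R _ Gu.
    have vE2 : v = smul (u * g) (smul u^-1 w).
      by rewrite vE smulA mulrAC mulrV// mul1r.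
    exfalso; apply: (H (sig s / sig (u * g))).
      by rewrite divr_gt0//= ltr_pdivrMr// mul1r.
    exists (smul s (smul u^-1 w)); last first.
      by rewrite [in RHS]vE2 !pos_smul [RHS]scalerA divfK// gt_eqF.
    suff : W (star (smul s (smul u^-1 w))) by [].
    have -> : star (smul s (smul u^-1 w)) = (sigb s / sigb (u * g)) *: star v.
      by rewrite vE2 !(star_smul R (u * g)) !(star_smul R s) scalerA divfK// gt_eqF.
    apply: window_scale => //.
    by rewrite normrM normfV (gtr0_norm p2) ler_pdivrMr// mul1r.
  (* The conjugate of sqrt 2 - 1 is -(1 + sqrt 2), and the window is symmetric. *)
  move=> W'; apply: (H (s2 - 1)); first by apply/andP; split; lra.
  exists (smul (ZS2 (-1) 1) v).
    rewrite /= star_smul (_ : sigb _ = -1 * (1 + s2)); last first.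
      by rewrite /sigb /= rmorphN; ring.
    by rewrite -scalerA; apply: window_scale => //; rewrite normrN normr1.
  by rewrite pos_smul (_ : sig _ = s2 - 1)// /sig /= rmorphN mul1r addrC.
move=> _ [v [pv Wv nW] <-]; split; first by exists v.
move=> t /andP[t0 t1] [v' Wv' E]; apply: nW.
have E1 : sig v'.1 = t * sig v.1 := congr1 fst E.
have E2' : sig (v'.1 + rt2 * v'.2) = t * sig (v.1 + rt2 * v.2) := congr1 snd E.
have E2 : sig v'.2 = t * sig v.2.
  apply: (mulfI (lt0r_neq0 (sqrt2_gt0 R))).
  have E3 : t * sig v.1 + s2 * sig v'.2 = t * (sig v.1 + s2 * sig v.2).
    by rewrite -E1 -sig_rt2 -!sigM -!sigD.
  by apply: (@addrI _ (t * sig v.1)); rewrite E3; ring.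
(* Write t = y' / x' in lowest terms, using a nonzero coordinate; x' then divides the primitive
   vector [v], so it is a unit. *)
have [s sE] : exists s, t = sig s.
  have : v.1 != 0 \/ v.2 != 0.
    have := prim_neq0 pv; case: (v) => a b.
    by case: (eqVneq a 0) => [->|]; [case: (eqVneq b 0) => [->|]; [|right]|left].
  have key x y : x != 0 -> sig y = t * sig x -> exists s, t = sig s.
    move=> x0 xy; have [h [x' [y' [u [w [xE yE h0 uw]]]]]] := zs2_bezout y x0.
    have h0' : sig h != 0 by rewrite sig_eq0.
    have ty : sig y' = t * sig x'.
      by apply: (mulIf h0'); rewrite -mulrA -!sigM -xE -yE.
    have aux a b : sig b = t * sig a -> x' * b = y' * a.
      by move=> ab; apply: (@sig_inj R); rewrite !sigM ab ty; ring.
    have ux : x' \is a GRing.unit.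
      apply: (pv x' (u * v.1 + w * v'.1, u * v.2 + w * v'.2)).
      rewrite [LHS](surjective_pairing v) /smul /=; congr pair.
        by rewrite -[LHS]mul1r -uw mulrDr [x' * (w * _)]mulrCA (aux _ _ E1); ring.
      by rewrite -[LHS]mul1r -uw mulrDr [x' * (w * _)]mulrCA (aux _ _ E2); ring.
    exists (y' * x'^-1).
    have x'0 : sig x' != 0.
      by rewrite sig_eq0; apply: contraTneq ux => ->; rewrite unitr0.
    by apply: (mulIf x'0); rewrite -sigM divrK// ty.
  by case=> [v0|v0]; [exact: key v0 E1|exact: key v0 E2].
have v'E : v' = smul s v.
  by apply: (@pos_inj R); rewrite pos_smul -sE E.
have s1 : 1 + s2 <= `|sigb s| by apply: conj_of_small; rewrite -sE t0.
have sp : 0 < `|sigb s| by lra.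
have sn0 : sigb s != 0 by rewrite -normr_gt0.
have -> : (1 + s2) *: star v = ((1 + s2) / sigb s) *: star v'.
  by rewrite v'E star_smul scalerA divfK.
apply: window_scale => //; rewrite normrM normfV ler_pdivrMr// mul1r.
by rewrite ger0_norm//; lra.
Qed.

End AmmannBeenker.

(** * The densities of the point set and of its visible points *)

Section Final.
Variable R : realType.
Local Notation s2 := (Num.sqrt (2 : R)).
Local Notation pos := (@pos R).
Local Notation star := (@star R).
Local Notation W := (@window R).
Local Notation A := (ammann_beenker R).
Local Notation Z := (dedekind_zeta (Qsqrt2 R) 2).
Implicit Types (D : set (R * R)) (S : set (zs2 * zs2)).

Lemma dilate1 D : dilate 1 D = D.
Proof.
by apply/seteqP; split=> [_ [x Dx <-]|x Dx]; [rewrite scale1r|exists x; rewrite ?scale1r].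
Qed.

Lemma window_points_finite D r : bounded_set D -> 0 < r ->
  finite_set (points (dilate r D) W).
Proof.
move=> bD r0; have [B _ HB] := nonzeros_bound bD (@window_bounded R).
have [fN _] := HB r 1 r0 ltr01.
apply: (@sub_finite_set _ _ (nonzeros D W r 1 `|` [set 0])).
  move=> v [h1 h2]; have [->|v0] := eqVneq v 0; [by right|left].
  by split=> //; rewrite dilate1.
by rewrite finite_setU.
Qed.

Lemma scaled_points_count S D r : S `<=` [set v | W (star v)] -> bounded_set D -> 0 < r ->
  finite_set (dilate s2^-1 (pos @` S) `&` dilate r D) /\
  cnt (dilate s2^-1 (pos @` S) `&` dilate r D) =
  cnt [set v | S v /\ dilate (r * s2) D (pos v)].
Proof.
move=> SW bD r0; have s0 := sqrt2_gt0 R.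
have E : dilate s2^-1 (pos @` S) `&` dilate r D =
    (fun v => s2^-1 *: pos v) @` [set v | S v /\ dilate (r * s2) D (pos v)].
  have eqv x : dilate r D (s2^-1 *: x) <-> dilate (r * s2) D x.
    by rewrite dilate_scale ?invr_eq0 ?gt_eqF// invrK.
  apply/seteqP; split.
    by move=> _ [[_ [v Sv <-] <-] /eqv h]; exists v.
  by move=> _ [v [Sv /eqv h] <-]; split=> //; exists (pos v) => //; exists v.
have fS : finite_set [set v | S v /\ dilate (r * s2) D (pos v)].
  apply: sub_finite_set (window_points_finite bD (mulr_gt0 r0 s0)).
  by move=> v [/SW].
rewrite E; split; first exact: finite_image.
apply: cnt_image => // v w _ _ h; apply: (@pos_inj R).
by apply: (@scalerI _ _ s2^-1) h; rewrite invr_eq0 gt_eqF.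
Qed.

(** Shrinking the plane by sqrt 2 doubles the density, hence the 1/2 in the assumed limit. *)
Lemma scaled_points_density S theta : S `<=` [set v | W (star v)] ->
  (forall D a, jordan_measurable D -> area D = a%:E -> 0 < a ->
    (cnt [set v | S v /\ dilate r D (pos v)])%:R / r ^+ 2 @[r --> +oo] --> a * theta / 2) ->
  has_density (dilate s2^-1 (pos @` S)) theta.
Proof.
move=> SW HS; have s0 := sqrt2_gt0 R; split.
  move=> B bB; have [+ _] := scaled_points_count SW bB ltr01.
  by rewrite dilate1.
move=> D jD; have [a a0 aE] := jordan_area jD; rewrite aE lte_fin => a0'.
have := HS D a jD aE a0' => H.
have H2 : (cnt [set v | S v /\ dilate (r * s2) D (pos v)])%:R / (r * s2) ^+ 2
    @[r --> +oo] --> a * theta / 2.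
  move/cvgrPdist_le : H => H; apply/cvgrPdist_le => e e0.
  have si : 0 < s2^-1 by rewrite invr_gt0.
  have := near_pinfty_div si (H e e0); apply: filterS => r /=.
  by rewrite invrK.
have -> : theta = (a * theta / 2) * (2 / a) by field; rewrite gt_eqF.
have H3 : (cnt [set v | S v /\ dilate (r * s2) D (pos v)])%:R / (r * s2) ^+ 2 * (2 / a)
    @[r --> +oo] --> a * theta / 2 * (2 / a) by exact: cvgMl.
apply: cvg_trans H3; apply: near_eq_cvg; near=> r.
have r0 : 0 < r by near: r; exact: nbhs_pinfty_gt.
rewrite (area_dilate r0 jD aE) /=.
have [_] := scaled_points_count SW jD.1 r0; rewrite /cnt => ->.
rewrite exprMn sqrt2_sqr; field.
by rewrite (gt_eqF a0') (gt_eqF r0).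
Unshelve. all: by end_near.
Qed.

Lemma ammann_beenker_density b : area W = b%:E -> has_density A (b / 8).
Proof.
move=> bE; rewrite /ammann_beenker ammann_beenker_scaledE.
apply: scaled_points_density => // D a jD aE _.
have -> : a * (b / 8) / 2 = a * b * 1 ^+ 2 / 16 by field.
have := points_cvg jD (@window_jordan R) ltr01 aE bE; rewrite dilate1.
apply: cvg_trans; apply: near_eq_cvg; near=> r.
congr ((cnt _)%:R / _).
by apply/seteqP; split=> v [].
Unshelve. all: by end_near.
Qed.

Lemma visible_ammann_beenker_density b : 0 < b -> area W = b%:E ->
  has_density (visible A) (b / 8 * (2 * (s2 - 1) / Z)).
Proof.
move=> b0 bE; have s0 := sqrt2_gt0 R; have /andP[sl su] := sqrt2_bounds R.
have Z1 : 1 <= Z by rewrite dedekind_zetaE; exact: zeta_ge1.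
have Z0 : Z != 0 by rewrite gt_eqF// (lt_le_trans ltr01).
rewrite /ammann_beenker visible_dilate ?invr_eq0 ?gt_eqF// visible_scaledE.
apply: scaled_points_density => [v []//|D a jD aE a0].
have l0 : 0 < s2 - 1 by lra.
have C0 : 0 <= a * b / 16 by rewrite divr_ge0// mulr_ge0// ltW.
have lim l : 0 < l -> (cnt (prims D W r l))%:R / r ^+ 2 @[r --> +oo] -->
    a * b / 16 / Z * l ^+ 2.
  move=> lp; have := prims_density jD.1 (@window_bounded R) C0
    (fun l l0 => nonzeros_cvg jD (@window_jordan R) l0 aE bE) lp.
  rewrite -dedekind_zetaE => h.
  have h3 : (cnt (prims D W r l))%:R / (r * l) ^+ 2 * l ^+ 2
    @[r --> +oo] --> a * b / 16 / Z * l ^+ 2 by exact: cvgMl.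
  apply: cvg_trans h3; apply: near_eq_cvg; near=> r.
  have r0 : 0 < r by near: r; exact: nbhs_pinfty_gt.
  by field; rewrite (gt_eqF r0) (gt_eqF lp).
(* The identity 1 - (sqrt 2 - 1)^2 = 2 (sqrt 2 - 1) produces the numerator of the final constant. *)
have -> : a * (b / 8 * (2 * (s2 - 1) / Z)) / 2 =
    a * b / 16 / Z * 1 ^+ 2 - a * b / 16 / Z * (s2 - 1) ^+ 2.
  have := sqrt2_sqr R; set t := s2 => t2.
  have -> : (t - 1) ^+ 2 = 3 - 2 * t by rewrite sqrrB t2; ring.
  by field.
apply: cvg_trans (cvgB (lim 1 ltr01) (lim _ l0)); apply: near_eq_cvg; near=> r.
have r0 : 0 < r by near: r; exact: nbhs_pinfty_gt.
have [B _ HB] := nonzeros_bound jD.1 (@window_bounded R).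
have finP l : 0 < l -> finite_set (prims D W r l).
  by move=> lp; apply: sub_finite_set (@prims_sub _ _ _ _ _) (HB r l r0 lp).1.
have inv : (1 + s2) * (s2 - 1) = 1.
  have -> : (1 + s2) * (s2 - 1) = s2 ^+ 2 - 1 by ring.
  by rewrite sqrt2_sqr; ring.
have dW x : dilate (s2 - 1) W x <-> W ((1 + s2) *: x).
  rewrite dilateP ?gt_eqF//; have -> // : (s2 - 1)^-1 = 1 + s2.
  by apply: (mulIf (lt0r_neq0 l0)); rewrite inv mulVf// gt_eqF.
(* Since (sqrt 2 - 1) W is contained in W, the visible points are counted by a difference of two
   primitive counts. *)
have E : prims D W r 1 =
    [set v | visible_index R v /\ dilate r D (pos v)] `|` prims D W r (s2 - 1).
  rewrite /prims dilate1; apply/seteqP; split.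
    move=> v [pv vD vW]; have [/dW h|nW] := pselect (W ((1 + s2) *: star v)); first by right.
    by left; split.
  move=> v [[[pv vW _] vD]|[pv vD /dW vW]]; split=> //.
  have -> : star v = (s2 - 1) *: ((1 + s2) *: star v) by rewrite scalerA mulrC inv scale1r.
  by apply: window_scale => //; rewrite ger0_norm; lra.
have fV : finite_set [set v | visible_index R v /\ dilate r D (pos v)].
  by apply: sub_finite_set (finP 1 ltr01); rewrite E; left.
rewrite ?fctE /= E cntU//; first by rewrite natrD mulrDl addrK.
  exact: finP.
apply/seteqP; split=> // v [[[_ _ nW] _] [_ _ /dW]]; exact: nW.
Unshelve. all: by end_near.
Qed.
End Final.

Theorem mainTheorem1 (R : realType) :
  has_relative_visible_density (ammann_beenker R)
    (2 * (Num.sqrt 2 - 1) / dedekind_zeta (Qsqrt2 R) 2).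
Proof.
have [b b0 bE] := @window_area R.
exists (b / 8), (b / 8 * (2 * (Num.sqrt 2 - 1) / dedekind_zeta (Qsqrt2 R) 2)).
have b80 : 0 < b / 8 by rewrite divr_gt0.
split=> //; first exact: ammann_beenker_density.
  exact: visible_ammann_beenker_density.
by rewrite [RHS]mulrAC mulfV ?mul1r// gt_eqF.
Qed.
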